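(* Let $\mathfrak{g}$ be a complex semisimple Lie algebra with fixed Borel subalgebra $\mathfrak{b}$ and Cartan subalgebra $\mathfrak{h}\subset\mathfrak{b}$. Let $\lambda\in\mathfrak{h}^*$ and let $M(\lambda)=U(\mathfrak{g})\otimes_{U(\mathfrak{b})}\mathbb{C}_\lambda$ be the corresponding Verma module. Then there exists a unique contravariant form on $M(\lambda)$ up to scaling; that is, there exists a nonzero contravariant form on $M(\lambda)$, and every contravariant form on $M(\lambda)$ is a scalar multiple of it.
   Context: Let $\Pi\subset\Sigma^+\subset\mathfrak{h}^*$ be the simple and positive roots determined by $\mathfrak{b}$, with root spaces $\mathfrak{g}_\alpha$, and let $\mathfrak{n}=[\mathfrak{b},\mathfrak{b}]$. Fix a Chevalley basis $\{y_\alpha,x_\alpha\}_{\alpha\in\Sigma^+}\cup\{h_\alpha\}_{\alpha\in\Pi}$ with $x_\alpha\in\mathfrak{g}_\alpha$, $y_\alpha\in\mathfrak{g}_{-\alpha}$, $h_\alpha\in\mathfrak{h}$, $[x_\alpha,y_\alpha]=h_\alpha$. $\mathbb{C}_\lambda$ is the one-dimensional $\mathfrak{b}$-module on which $\mathfrak{h}$ acts by $\lambda$ and $\mathfrak{n}$ acts by zero. Let $\tau:U(\mathfrak{g})\to U(\mathfrak{g})$ be the antiautomorphism with $\tau(x_\alpha)=y_\alpha$, $\tau(y_\alpha)=x_\alpha$, $\tau(h_\alpha)=h_\alpha$. A contravariant form on a $U(\mathfrak{g})$-module $X$ is a symmetric bilinear form $\langle\cdot,\cdot\rangle:X\times X\to\mathbb{C}$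 with $\langle uv,w\rangle=\langle v,\tau(u)w\rangle$ for all $u\in U(\mathfrak{g})$, $v,w\in X$. *)

(* Defs.v *)
From HB Require Import structures.
From mathcomp Require Import all_boot all_algebra.
From mathcomp Require Import boolp.

Set Implicit Arguments.
Unset Strict Implicit.
Unset Printing Implicit Defensive.

Import GRing.Theory.
Local Open Scope ring_scope.
Local Open Scope quotient_scope.

HB.mixin Record Vector_isLieAlgebra (F : fieldType) (g : Type)
    of Vector F g := {
  lie : g -> g -> g;
  lie_linearl : forall y, linear (lie^~ y);
  lie_linearr : forall x, linear (lie x);
  lie_alt : forall x, lie x x = 0;
  lie_jacobi : forall x y z,
    lie x (lie y z) + lie y (lie z x) + lie z (lie x y) = 0
}.

#[short(type="lieAlgType")]
HB.structure Definition LieAlgebra (F : fieldType) :=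
  {g of Vector_isLieAlgebra F g & Vector F g}.

Reserved Notation "[lie x , y ]" (format "[lie  x ,  y ]").
Notation "[lie x , y ]" := (lie x y) : ring_scope.

Section LieTheory.
Variables (F : fieldType) (g : lieAlgType F).
Implicit Types (U V I : {vspace g}).

Definition lie_prodv U V : {vspace g} :=
  <<[seq [lie u, v] | u <- vbasis U, v <- vbasis V]>>%VS.

Definition is_subalgebra U :=
  forall x y, x \in U -> y \in U -> [lie x, y] \in U.

Definition is_ideal I := forall x y, y \in I -> [lie x, y] \in I.

Definition solvable U := exists n, iter n (fun V => lie_prodv V V) U = 0%VS.

Definition nilpotent U := exists n, iter n (lie_prodv U) U = 0%VS.

Definition self_normalizing U :=
  forall x, (forall y, y \in U -> [lie x, y] \in U) -> x \in U.

Record subalgebra := Subalgebra {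
  subalg_vs :> {vspace g};
  subalgP : is_subalgebra subalg_vs
}.

Definition is_cartan (h : subalgebra) := nilpotent h /\ self_normalizing h.

Definition is_borel (b : subalgebra) :=
  solvable b /\
  forall c : subalgebra, solvable c -> (b <= c)%VS -> c = b :> {vspace g}.

End LieTheory.

Definition semisimple (F : fieldType) (g : lieAlgType F) :=
  forall I : {vspace g}, is_ideal I -> solvable I -> I = 0%VS.

Section SubalgebraLie.
Variables (F : fieldType) (g : lieAlgType F) (b : subalgebra g).

Definition sub_lie (x y : subvs_of b) : subvs_of b :=
  Subvs (subalgP (subvsP x) (subvsP y)).

Fact sub_lie_linearl y : linear (sub_lie^~ y).
Proof. by move=> c u v; apply: val_inj; rewrite /= lie_linearl. Qed.
Fact sub_lie_linearr x : linear (sub_lie x).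
Proof. by move=> c u v; apply: val_inj; rewrite /= lie_linearr. Qed.
Fact sub_lie_alt x : sub_lie x x = 0.
Proof. by apply: val_inj; rewrite /= lie_alt. Qed.
Fact sub_lie_jacobi x y z :
  sub_lie x (sub_lie y z) + sub_lie y (sub_lie z x)
    + sub_lie z (sub_lie x y) = 0.
Proof. by apply: val_inj; rewrite /= lie_jacobi. Qed.

HB.instance Definition _ := Vector_isLieAlgebra.Build F (subvs_of b)
  sub_lie_linearl sub_lie_linearr sub_lie_alt sub_lie_jacobi.

End SubalgebraLie.

Section Roots.
Variables (F : fieldType) (g : lieAlgType F) (h b : subalgebra g).
Implicit Types alpha beta : 'Hom(subvs_of h, F^o).

Definition in_root_space alpha (x : g) :=
  forall t : subvs_of h, [lie vsval t, x] = (alpha t : F) *: x.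

Definition is_root alpha :=
  alpha != 0 /\ exists2 x, in_root_space alpha x & x != 0.

Definition is_positive_root alpha :=
  is_root alpha /\ forall x, in_root_space alpha x -> x \in subalg_vs b.

Definition is_simple_root alpha :=
  is_positive_root alpha /\
  ~ exists beta gamma,
      [/\ is_positive_root beta, is_positive_root gamma
        & alpha = beta + gamma].

(* [chev_x], [chev_y] and [chev_h] are only constrained on positive roots.
   The normalisation [alpha (chev_h alpha) = 2] makes [chev_h alpha] the
   coroot of [alpha], for every positive root; only those of the simple roots
   belong to the basis.  [chev_e] gathers x and y into one family indexed by
   all the roots, with e_alpha = x_alpha and e_{-alpha} = y_alpha for alpha
   positive; [chev_struct] is the condition c_{alpha,beta} =
   - c_{-alpha,-beta} on the structure constants. *)
Record chevalley_basis := ChevalleyBasis {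
  pos_roots : seq 'Hom(subvs_of h, F^o);
  simple_roots : seq 'Hom(subvs_of h, F^o);
  chev_x : 'Hom(subvs_of h, F^o) -> g;
  chev_y : 'Hom(subvs_of h, F^o) -> g;
  chev_h : 'Hom(subvs_of h, F^o) -> subvs_of h;
  chev_e := fun alpha =>
    if alpha \in pos_roots then chev_x alpha else chev_y (- alpha);
  pos_roots_uniq : uniq pos_roots;
  pos_rootsP : forall alpha, alpha \in pos_roots <-> is_positive_root alpha;
  simple_roots_uniq : uniq simple_roots;
  simple_rootsP :
    forall alpha, alpha \in simple_roots <-> is_simple_root alpha;
  chev_basis : basis_of fullv
    ([seq chev_y alpha | alpha <- pos_roots]
       ++ [seq chev_x alpha | alpha <- pos_roots]
       ++ [seq vsval (chev_h alpha) | alpha <- simple_roots]);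
  chev_x_root :
    forall alpha, alpha \in pos_roots -> in_root_space alpha (chev_x alpha);
  chev_y_root :
    forall alpha, alpha \in pos_roots -> in_root_space (- alpha) (chev_y alpha);
  chev_xy : forall alpha, alpha \in pos_roots ->
    [lie chev_x alpha, chev_y alpha] = vsval (chev_h alpha);
  chev_coroot :
    forall alpha, alpha \in pos_roots -> alpha (chev_h alpha) = 2%:R;
  chev_struct : forall alpha beta (c : F),
    is_root alpha -> is_root beta -> is_root (alpha + beta) ->
    [lie chev_e alpha, chev_e beta] = c *: chev_e (alpha + beta) ->
    [lie chev_e (- alpha), chev_e (- beta)] =
      - c *: chev_e (- (alpha + beta))
}.

End Roots.

(* U(g) is the unital associative algebra generated by the vector space g
   subject to x y - y x = [x, y]: formal expressions in constants and elements
   of g, modulo the congruence generated by the laws of an associative algebra,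
   the linearity of g -> U(g) and the commutator relation.  [uext],
   [uext_uinj] and [uext_unique] give its universal property. *)

Section UEnv.
Variables (F : fieldType) (g : lieAlgType F).

Inductive uterm :=
  | UCst of F
  | UGen of g
  | UAdd of uterm & uterm
  | UMul of uterm & uterm.

Inductive ucong : uterm -> uterm -> Prop :=
  | ucong_refl s : ucong s s
  | ucong_sym s t : ucong s t -> ucong t s
  | ucong_trans s t u : ucong s t -> ucong t u -> ucong s u
  | ucong_add s s' t t' :
      ucong s s' -> ucong t t' -> ucong (UAdd s t) (UAdd s' t')
  | ucong_mul s s' t t' :
      ucong s s' -> ucong t t' -> ucong (UMul s t) (UMul s' t')
  | ucong_addA s t u : ucong (UAdd s (UAdd t u)) (UAdd (UAdd s t) u)
  | ucong_addC s t : ucong (UAdd s t) (UAdd t s)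
  | ucong_add0 s : ucong (UAdd (UCst 0) s) s
  | ucong_addN s : ucong (UAdd (UMul (UCst (-1)) s) s) (UCst 0)
  | ucong_mulA s t u : ucong (UMul s (UMul t u)) (UMul (UMul s t) u)
  | ucong_mul1l s : ucong (UMul (UCst 1) s) s
  | ucong_mul1r s : ucong (UMul s (UCst 1)) s
  | ucong_mulDl s t u :
      ucong (UMul (UAdd s t) u) (UAdd (UMul s u) (UMul t u))
  | ucong_mulDr s t u :
      ucong (UMul s (UAdd t u)) (UAdd (UMul s t) (UMul s u))
  | ucong_cstD c d : ucong (UCst (c + d)) (UAdd (UCst c) (UCst d))
  | ucong_cstM c d : ucong (UCst (c * d)) (UMul (UCst c) (UCst d))
  | ucong_cstC c s : ucong (UMul (UCst c) s) (UMul s (UCst c))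
  | ucong_genD x y : ucong (UGen (x + y)) (UAdd (UGen x) (UGen y))
  | ucong_genZ c x : ucong (UGen (c *: x)) (UMul (UCst c) (UGen x))
  | ucong_lie x y :
      ucong (UMul (UGen x) (UGen y))
            (UAdd (UMul (UGen y) (UGen x)) (UGen [lie x, y])).

HB.instance Definition _ := gen_eqMixin uterm.
HB.instance Definition _ := gen_choiceMixin uterm.

Definition ucongb (s t : uterm) : bool := `[< ucong s t >].

Fact ucongb_equiv : equiv_class_of ucongb.
Proof.
split=> [s|s t|t s u]; first by apply/asboolP/ucong_refl.
  by apply/asboolP/asboolP; apply: ucong_sym.
by move=> /asboolP st /asboolP tu; apply/asboolP/(ucong_trans st tu).
Qed.

Canonical ucongb_equiv_rel := EquivRelPack ucongb_equiv.

Definition uenv := {eq_quot ucongb}.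

HB.instance Definition _ := Choice.on uenv.
HB.instance Definition _ := EqQuotient.on uenv.

Definition upi (s : uterm) : uenv := \pi_uenv s.

Lemma upiP s t : upi s = upi t <-> ucong s t.
Proof.
split; first by move/eqmodP/asboolP.
by move=> st; apply/eqmodP/asboolP.
Qed.

Lemma upi_repr (u : uenv) : upi (repr u) = u. Proof. exact: reprK. Qed.

Lemma repr_upi s : ucong (repr (upi s)) s.
Proof. by apply/upiP; rewrite upi_repr. Qed.

Definition uadd (u v : uenv) : uenv := upi (UAdd (repr u) (repr v)).
Definition umul (u v : uenv) : uenv := upi (UMul (repr u) (repr v)).
Definition ucst c : uenv := upi (UCst c).
Definition uinj (x : g) : uenv := upi (UGen x).

Lemma upi_add s t : upi (UAdd s t) = uadd (upi s) (upi t).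
Proof.
by apply/upiP/ucong_sym; apply: ucong_add; apply: repr_upi.
Qed.

Lemma upi_mul s t : upi (UMul s t) = umul (upi s) (upi t).
Proof.
by apply/upiP/ucong_sym; apply: ucong_mul; apply: repr_upi.
Qed.

Lemma uenv_ind (P : uenv -> Prop) : (forall s, P (upi s)) -> forall u, P u.
Proof. by move=> Ps u; rewrite -(upi_repr u). Qed.

Fact uaddA : associative uadd.
Proof.
elim/uenv_ind=> s; elim/uenv_ind=> t; elim/uenv_ind=> u.
by rewrite -!upi_add; apply/upiP; constructor.
Qed.
Fact uaddC : commutative uadd.
Proof.
elim/uenv_ind=> s; elim/uenv_ind=> t.
by rewrite -!upi_add; apply/upiP; constructor.
Qed.
Fact uadd0 : left_id (ucst 0) uadd.
Proof. by elim/uenv_ind=> s; rewrite -!upi_add; apply/upiP; constructor. Qed.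
Fact uaddN : left_inverse (ucst 0) (umul (ucst (-1))) uadd.
Proof.
by elim/uenv_ind=> s; rewrite -!upi_mul -!upi_add; apply/upiP; constructor.
Qed.

HB.instance Definition _ :=
  GRing.isZmodule.Build uenv uaddA uaddC uadd0 uaddN.

Fact umulA : associative umul.
Proof.
elim/uenv_ind=> s; elim/uenv_ind=> t; elim/uenv_ind=> u.
by rewrite -!upi_mul; apply/upiP; constructor.
Qed.
Fact umul1l : left_id (ucst 1) umul.
Proof. by elim/uenv_ind=> s; rewrite -!upi_mul; apply/upiP; constructor. Qed.
Fact umul1r : right_id (ucst 1) umul.
Proof. by elim/uenv_ind=> s; rewrite -!upi_mul; apply/upiP; constructor. Qed.
Fact umulDl : left_distributive umul +%R.
Proof.
elim/uenv_ind=> s; elim/uenv_ind=> t; elim/uenv_ind=> u.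
rewrite -[_ + _]upi_add -!upi_mul -[RHS]upi_add.
by apply/upiP; constructor.
Qed.
Fact umulDr : right_distributive umul +%R.
Proof.
elim/uenv_ind=> s; elim/uenv_ind=> t; elim/uenv_ind=> u.
rewrite -[_ + _]upi_add -!upi_mul -[RHS]upi_add.
by apply/upiP; constructor.
Qed.

Definition is_lie_morphism (A : algType F) (f : g -> A) :=
  linear f /\ forall x y, f [lie x, y] = f x * f y - f y * f x.

Fixpoint ueval (A : algType F) (f : g -> A) (s : uterm) : A :=
  match s with
  | UCst c => c%:A
  | UGen x => f x
  | UAdd s t => ueval f s + ueval f t
  | UMul s t => ueval f s * ueval f t
  end.

Lemma ueval_cong (A : algType F) (f : g -> A) s t :
  is_lie_morphism f -> ucong s t -> ueval f s = ueval f t.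
Proof.
move=> [flin flie].
have fD x y : f (x + y) = f x + f y.
  by rewrite -[x in LHS]scale1r flin scale1r.
have f0 : f 0 = 0 by apply: (addrI (f 0)); rewrite -fD !addr0.
have fZ c x : f (c *: x) = c *: f x.
  by rewrite -[c *: x]addr0 flin f0 addr0.
elim=> //=.
- by move=> ? ? ? _ -> _ ->.
- by move=> ? ? ? ? _ -> _ ->.
- by move=> ? ? ? ? _ -> _ ->.
- by move=> *; rewrite addrA.
- by move=> *; rewrite addrC.
- by move=> *; rewrite scale0r add0r.
- by move=> *; rewrite scaleN1r mulN1r addNr scale0r.
- by move=> *; rewrite mulrA.
- by move=> *; rewrite scale1r mul1r.
- by move=> *; rewrite scale1r mulr1.
- by move=> *; rewrite mulrDl.
- by move=> *; rewrite mulrDr.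
- by move=> *; rewrite scalerDl.
- by move=> *; rewrite mulr_algl scalerA.
- by move=> *; rewrite mulr_algl mulr_algr.
- by move=> *; rewrite mulr_algl fZ.
- by move=> *; rewrite flie addrC subrK.
Qed.

Fact uenv_oner_neq0 : ucst 1 != 0 :> uenv.
Proof.
apply/eqP => /upiP /(@ueval_cong F^o (fun=> 0)) /=.
have f0 : is_lie_morphism (fun=> 0 : F^o).
  by split=> [c x y|x y]; rewrite ?scaler0 ?mulr0 ?subr0 ?addr0.
by move=> /(_ f0) /eqP; rewrite scale1r scale0r oner_eq0.
Qed.

HB.instance Definition _ := GRing.Zmodule_isNzRing.Build uenv
  umulA umul1l umul1r umulDl umulDr uenv_oner_neq0.

Definition uscale c (u : uenv) : uenv := ucst c * u.

Fact uscaleA c d u : uscale c (uscale d u) = uscale (c * d) u.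
Proof.
rewrite /uscale mulrA; congr (_ * _).
by rewrite -[LHS]upi_mul; apply/upiP/ucong_sym; constructor.
Qed.
Fact uscale1 : left_id 1 uscale.
Proof. exact: mul1r. Qed.
Fact uscaleDr : right_distributive uscale +%R.
Proof. by move=> *; rewrite /uscale mulrDr. Qed.
Fact uscaleDl u : {morph uscale^~ u : c d / c + d}.
Proof.
move=> c d; rewrite /uscale -mulrDl; congr (_ * _).
by rewrite -[RHS]upi_add; apply/upiP; constructor.
Qed.

HB.instance Definition _ := GRing.Zmodule_isLmodule.Build F uenv
  uscaleA uscale1 uscaleDr uscaleDl.

Fact uscaleAl (c : F) (u v : uenv) : c *: (u * v) = (c *: u) * v.
Proof. exact: mulrA. Qed.

HB.instance Definition _ := GRing.Lmodule_isLalgebra.Build F uenv uscaleAl.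

Lemma ucst_comm c (u : uenv) : ucst c * u = u * ucst c.
Proof.
elim/uenv_ind: u => s; rewrite -[LHS]upi_mul -[RHS]upi_mul.
by apply/upiP; constructor.
Qed.

Fact uscaleAr (c : F) (u v : uenv) : c *: (u * v) = u * (c *: v).
Proof. by rewrite -[LHS]/(ucst c * _) mulrA ucst_comm -mulrA. Qed.

HB.instance Definition _ := GRing.Lalgebra_isAlgebra.Build F uenv uscaleAr.

Lemma ucstE c : ucst c = c%:A.
Proof. by rewrite -[RHS]/(ucst c * 1) mulr1. Qed.

Lemma uinj_lie_morphism : is_lie_morphism uinj.
Proof.
split=> [c x y|x y].
  rewrite -[c *: uinj x]upi_mul -[RHS]upi_add; apply/upiP.
  apply: (ucong_trans (ucong_genD _ _)).
  by apply: ucong_add; constructor.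
apply/eqP; rewrite eq_sym subr_eq addrC; apply/eqP.
rewrite -[LHS]upi_mul -[uinj y * _]upi_mul -[RHS]upi_add; apply/upiP.
by constructor.
Qed.

Definition uext (A : algType F) (f : g -> A) (u : uenv) : A :=
  ueval f (repr u).

Section UniversalProperty.
Variables (A : algType F) (f : g -> A).
Hypothesis f_lie : is_lie_morphism f.

Lemma uext_upi s : uext f (upi s) = ueval f s.
Proof. exact: ueval_cong f_lie (repr_upi s). Qed.

Lemma uext_uinj x : uext f (uinj x) = f x.
Proof. exact: uext_upi. Qed.

Lemma uext_zmod_morphism : zmod_morphism (uext f).
Proof.
elim/uenv_ind=> s; elim/uenv_ind=> t.
rewrite -[- upi t]upi_mul -[_ + _]upi_add !uext_upi /=.
by rewrite scaleN1r mulN1r.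
Qed.

Lemma uext_monoid_morphism : monoid_morphism (uext f).
Proof.
split; first by rewrite uext_upi /= scale1r.
elim/uenv_ind=> s; elim/uenv_ind=> t.
by rewrite -[_ * _ in LHS]upi_mul !uext_upi.
Qed.

Lemma uext_scalable : scalable (uext f).
Proof.
by move=> c u; rewrite -[c *: u]/(ucst c * u) uext_monoid_morphism.2 uext_upi mulr_algl.
Qed.

Lemma uext_unique (k : {lrmorphism uenv -> A}) :
  (forall x, k (uinj x) = f x) -> k =1 uext f.
Proof.
move=> kf; elim/uenv_ind=> s; rewrite uext_upi.
elim: s => [c|x|s IHs t IHt|s IHs t IHt] //=.
- by rewrite -[upi _]/(ucst c) ucstE linearZ rmorph1.
- exact: kf.
- have -> : upi (UAdd s t) = upi s + upi t := upi_add s t.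
  by rewrite rmorphD /= IHs IHt.
- have -> : upi (UMul s t) = upi s * upi t := upi_mul s t.
  by rewrite rmorphM /= IHs IHt.
Qed.

End UniversalProperty.
End UEnv.

Section UIncl.
Variables (F : fieldType) (g : lieAlgType F) (b : subalgebra g).

Definition uincl : uenv (subvs_of b) -> uenv g :=
  uext (fun x : subvs_of b => uinj (vsval x)).

Fact uincl_lie_morphism :
  is_lie_morphism (fun x : subvs_of b => uinj (vsval x)).
Proof.
have [uinj_lin uinj_lie] := uinj_lie_morphism g.
by split=> [c x y|x y]; [apply: uinj_lin | apply: uinj_lie].
Qed.

HB.instance Definition _ := GRing.isZmodMorphism.Build _ _ uincl
  (uext_zmod_morphism uincl_lie_morphism).
HB.instance Definition _ := GRing.isMonoidMorphism.Build _ _ uincl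
  (uext_monoid_morphism uincl_lie_morphism).

End UIncl.

Arguments uincl {F g} b u.

(* For a ring morphism phi : S -> A and a left S-module N, this is the left
   A-module A (x)_S N, with A a right S-module through phi: the abelian group
   generated by the pure tensors a (x) n, modulo biadditivity and
   (a phi(s)) (x) n = a (x) (s n).  [tlift], [tlift_pure] and [tlift_unique]
   give its universal property. *)

Section ExtensionOfScalars.
Variables (S A : pzRingType) (phi : {rmorphism S -> A}) (N : lmodType S).

Inductive tterm :=
  | TZero
  | TPure of A & N
  | TOpp of tterm
  | TAdd of tterm & tterm.

Inductive tcong : tterm -> tterm -> Prop :=
  | tcong_refl s : tcong s s
  | tcong_sym s t : tcong s t -> tcong t s
  | tcong_trans s t u : tcong s t -> tcong t u -> tcong s u
  | tcong_opp s s' : tcong s s' -> tcong (TOpp s) (TOpp s')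
  | tcong_add s s' t t' :
      tcong s s' -> tcong t t' -> tcong (TAdd s t) (TAdd s' t')
  | tcong_addA s t u : tcong (TAdd s (TAdd t u)) (TAdd (TAdd s t) u)
  | tcong_addC s t : tcong (TAdd s t) (TAdd t s)
  | tcong_add0 s : tcong (TAdd TZero s) s
  | tcong_addN s : tcong (TAdd (TOpp s) s) TZero
  | tcong_pureDl a a' n :
      tcong (TPure (a + a') n) (TAdd (TPure a n) (TPure a' n))
  | tcong_pureDr a n n' :
      tcong (TPure a (n + n')) (TAdd (TPure a n) (TPure a n'))
  | tcong_balanced a s n : tcong (TPure (a * phi s) n) (TPure a (s *: n)).

HB.instance Definition _ := gen_eqMixin tterm.
HB.instance Definition _ := gen_choiceMixin tterm.

Definition tcongb (s t : tterm) : bool := `[< tcong s t >].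

Fact tcongb_equiv : equiv_class_of tcongb.
Proof.
split=> [s|s t|t s u]; first by apply/asboolP/tcong_refl.
  by apply/asboolP/asboolP; apply: tcong_sym.
by move=> /asboolP st /asboolP tu; apply/asboolP/(tcong_trans st tu).
Qed.

Canonical tcongb_equiv_rel := EquivRelPack tcongb_equiv.

Definition ext_scalars := {eq_quot tcongb}.

HB.instance Definition _ := Choice.on ext_scalars.
HB.instance Definition _ := EqQuotient.on ext_scalars.

Definition tpi (s : tterm) : ext_scalars := \pi_ext_scalars s.

Lemma tpiP s t : tpi s = tpi t <-> tcong s t.
Proof.
split; first by move/eqmodP/asboolP.
by move=> st; apply/eqmodP/asboolP.
Qed.

Lemma tpi_repr (u : ext_scalars) : tpi (repr u) = u. Proof. exact: reprK. Qed.

Lemma repr_tpi s : tcong (repr (tpi s)) s.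
Proof. by apply/tpiP; rewrite tpi_repr. Qed.

Lemma ext_scalars_ind (P : ext_scalars -> Prop) :
  (forall s, P (tpi s)) -> forall u, P u.
Proof. by move=> Ps u; rewrite -(tpi_repr u). Qed.

Definition tadd (u v : ext_scalars) := tpi (TAdd (repr u) (repr v)).
Definition topp (u : ext_scalars) := tpi (TOpp (repr u)).
Definition tpure (a : A) (n : N) : ext_scalars := tpi (TPure a n).

Lemma tpi_add s t : tpi (TAdd s t) = tadd (tpi s) (tpi t).
Proof. by apply/tpiP/tcong_sym; apply: tcong_add; apply: repr_tpi. Qed.

Lemma tpi_opp s : tpi (TOpp s) = topp (tpi s).
Proof. by apply/tpiP/tcong_sym; apply: tcong_opp; apply: repr_tpi. Qed.

Fact taddA : associative tadd.
Proof.
elim/ext_scalars_ind=> s; elim/ext_scalars_ind=> t; elim/ext_scalars_ind=> u.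
by rewrite -!tpi_add; apply/tpiP; constructor.
Qed.
Fact taddC : commutative tadd.
Proof.
elim/ext_scalars_ind=> s; elim/ext_scalars_ind=> t.
by rewrite -!tpi_add; apply/tpiP; constructor.
Qed.
Fact tadd0 : left_id (tpi TZero) tadd.
Proof.
by elim/ext_scalars_ind=> s; rewrite -!tpi_add; apply/tpiP; constructor.
Qed.
Fact taddN : left_inverse (tpi TZero) topp tadd.
Proof.
elim/ext_scalars_ind=> s.
by rewrite -tpi_opp -!tpi_add; apply/tpiP; constructor.
Qed.

HB.instance Definition _ :=
  GRing.isZmodule.Build ext_scalars taddA taddC tadd0 taddN.

Lemma tpiD s t : tpi (TAdd s t) = tpi s + tpi t. Proof. exact: tpi_add. Qed.
Lemma tpiN s : tpi (TOpp s) = - tpi s. Proof. exact: tpi_opp. Qed.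
Lemma tpi0 : tpi TZero = 0. Proof. by []. Qed.
Lemma tpureDl a a' n : tpure (a + a') n = tpure a n + tpure a' n.
Proof. by rewrite -tpiD; apply/tpiP; constructor. Qed.
Lemma tpureDr a n n' : tpure a (n + n') = tpure a n + tpure a n'.
Proof. by rewrite -tpiD; apply/tpiP; constructor. Qed.
Lemma tpure_balanced a s n : tpure (a * phi s) n = tpure a (s *: n).
Proof. by apply/tpiP; constructor. Qed.

Section Eval.
Variables (V : zmodType) (f : A -> N -> V).
Hypothesis fDl : forall a a' n, f (a + a') n = f a n + f a' n.
Hypothesis fDr : forall a n n', f a (n + n') = f a n + f a n'.
Hypothesis f_balanced : forall a s n, f (a * phi s) n = f a (s *: n).

Fixpoint teval (s : tterm) : V :=
  match s with
  | TZero => 0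
  | TPure a n => f a n
  | TOpp s => - teval s
  | TAdd s t => teval s + teval t
  end.

Lemma teval_cong s t : tcong s t -> teval s = teval t.
Proof.
elim=> //=.
- by move=> ? ? ? _ -> _ ->.
- by move=> ? ? _ ->.
- by move=> ? ? ? ? _ -> _ ->.
- by move=> *; rewrite addrA.
- by move=> *; rewrite addrC.
- by move=> *; rewrite add0r.
- by move=> *; rewrite addNr.
Qed.

End Eval.

Definition tact (a : A) (u : ext_scalars) : ext_scalars :=
  teval (fun c n => tpure (a * c) n) (repr u).

Lemma tact_tpi a s :
  tact a (tpi s) = teval (fun c n => tpure (a * c) n) s.
Proof.
apply: teval_cong (repr_tpi s) => [c c' n|c n n'|c r n] /=.
- by rewrite mulrDr tpureDl.
- by rewrite tpureDr.
- by rewrite mulrA tpure_balanced.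
Qed.

Lemma tact_pure a c n : tact a (tpure c n) = tpure (a * c) n.
Proof. exact: tact_tpi. Qed.

Fact tactDr : right_distributive tact +%R.
Proof.
move=> a; elim/ext_scalars_ind=> s; elim/ext_scalars_ind=> t.
by rewrite -tpiD !tact_tpi.
Qed.

Lemma tact0 a : tact a 0 = 0. Proof. by rewrite -tpi0 tact_tpi. Qed.

Lemma tactN a u : tact a (- u) = - tact a u.
Proof. by elim/ext_scalars_ind: u => s; rewrite -tpiN !tact_tpi. Qed.

Lemma ext_scalars_pure_ind (P : ext_scalars -> Prop) :
    P 0 -> (forall a n, P (tpure a n)) -> (forall u, P u -> P (- u)) ->
    (forall u v, P u -> P v -> P (u + v)) ->
  forall u, P u.
Proof.
move=> P0 Pp PN PD; elim/ext_scalars_ind; elim=> [|a n|s IHs|s IHs t IHt] //.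
- exact: Pp.
- by rewrite tpiN; apply: PN.
- by rewrite tpiD; apply: PD.
Qed.

Fact tactA a c u : tact a (tact c u) = tact (a * c) u.
Proof.
elim/ext_scalars_pure_ind: u => [|d n|u IHu|u v IHu IHv].
- by rewrite !tact0.
- by rewrite !tact_pure mulrA.
- by rewrite !tactN IHu.
- by rewrite !tactDr IHu IHv.
Qed.

Fact tact1 : left_id 1 tact.
Proof.
elim/ext_scalars_pure_ind=> [|d n|u IHu|u v IHu IHv].
- by rewrite !tact0.
- by rewrite !tact_pure mul1r.
- by rewrite !tactN IHu.
- by rewrite !tactDr IHu IHv.
Qed.

Fact tactDl u : {morph tact^~ u : a c / a + c}.
Proof.
move=> a c; elim/ext_scalars_pure_ind: u => [|d n|u IHu|u v IHu IHv].
- by rewrite !tact0 addr0.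
- by rewrite !tact_pure mulrDl tpureDl.
- by rewrite !tactN IHu opprD.
- by rewrite !tactDr IHu IHv addrACA.
Qed.

HB.instance Definition _ := GRing.Zmodule_isLmodule.Build A ext_scalars
  tactA tact1 tactDr tactDl.

Lemma scale_tpure (a c : A) n : a *: tpure c n = tpure (a * c) n.
Proof. exact: tact_pure. Qed.

Section UniversalProperty.
Variables (P : lmodType A) (f : N -> P).
Hypothesis fD : forall n n', f (n + n') = f n + f n'.
Hypothesis fZ : forall s n, f (s *: n) = phi s *: f n.

Definition tlift (u : ext_scalars) : P := teval (fun a n => a *: f n) (repr u).

Lemma tlift_tpi s : tlift (tpi s) = teval (fun a n => a *: f n) s.
Proof.
apply: teval_cong (repr_tpi s) => [c c' n|c n n'|c r n] /=.
- by rewrite scalerDl.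
- by rewrite fD scalerDr.
- by rewrite fZ scalerA.
Qed.

Lemma tlift_pure a n : tlift (tpure a n) = a *: f n.
Proof. exact: tlift_tpi. Qed.

Lemma tlift_linear : linear tlift.
Proof.
have liftD u v : tlift (u + v) = tlift u + tlift v.
  elim/ext_scalars_ind: u => s; elim/ext_scalars_ind: v => t.
  by rewrite -tpiD !tlift_tpi.
have lift0 : tlift 0 = 0 by rewrite -tpi0 tlift_tpi.
have liftN u : tlift (- u) = - tlift u.
  by elim/ext_scalars_ind: u => s; rewrite -tpiN !tlift_tpi.
move=> a u v; rewrite liftD; congr (_ + _).
elim/ext_scalars_pure_ind: u => [|d n|u IHu|u w IHu IHw].
- by rewrite scaler0 lift0 scaler0.
- by rewrite scale_tpure !tlift_pure scalerA.
- by rewrite scalerN !liftN IHu scalerN.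
- by rewrite scalerDr !liftD IHu IHw scalerDr.
Qed.

Lemma tlift_unique (k : {linear ext_scalars -> P}) :
  (forall n, k (tpure 1 n) = f n) -> k =1 tlift.
Proof.
move=> kf u; have [k0 _] : tlift 0 = 0 /\ True by rewrite -tpi0 tlift_tpi.
have liftN w : tlift (- w) = - tlift w.
  by elim/ext_scalars_ind: w => s; rewrite -tpiN !tlift_tpi.
have liftD w v : tlift (w + v) = tlift w + tlift v.
  by rewrite -[w in LHS]scale1r tlift_linear scale1r.
elim/ext_scalars_pure_ind: u => [|d n|u IHu|u w IHu IHw].
- by rewrite linear0 k0.
- by rewrite tlift_pure -kf -linearZ scale_tpure mulr1.
- by rewrite linearN IHu liftN.
- by rewrite linearD IHu IHw liftD.
Qed.

End UniversalProperty.
End ExtensionOfScalars.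

Section Verma.
Variables (F : fieldType) (g : lieAlgType F) (h b : subalgebra g).

(* L is the one-dimensional b-module on which h acts by lambda and
   n = [b, b] acts by zero; b-modules are left U(b)-modules, on which a scalar
   c acts as [c%:A]. *)
Definition is_C_lambda (lambda : 'Hom(subvs_of h, F^o))
    (L : lmodType (uenv (subvs_of b))) :=
  [/\ exists2 e : L, e != 0 &
        forall v : L, exists c : F, v = (c%:A : uenv (subvs_of b)) *: e,
      forall (x : subvs_of b) (t : subvs_of h) (v : L),
        vsval x = vsval t ->
        uinj x *: v = ((lambda t : F)%:A : uenv (subvs_of b)) *: v
    & forall (x : subvs_of b) (v : L),
        vsval x \in lie_prodv b b -> uinj x *: v = 0].

Definition verma (L : lmodType (uenv (subvs_of b))) : lmodType (uenv g) :=
  ext_scalars (uincl b) L.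

Definition is_tau (B : chevalley_basis h b)
    (tau : {linear uenv g -> uenv g}) :=
  [/\ bijective tau, tau 1 = 1 /\ (forall u v, tau (u * v) = tau v * tau u),
      forall alpha, alpha \in pos_roots B ->
        tau (uinj (chev_x B alpha)) = uinj (chev_y B alpha),
      forall alpha, alpha \in pos_roots B ->
        tau (uinj (chev_y B alpha)) = uinj (chev_x B alpha)
    & forall alpha, alpha \in simple_roots B ->
        tau (uinj (vsval (chev_h B alpha))) = uinj (vsval (chev_h B alpha))].

(* Linearity in the second variable follows from symmetry. *)
Record contravariant_form (tau : uenv g -> uenv g) (X : lmodType (uenv g))
    (form : X -> X -> F) : Prop := ContravariantForm {
  cform_sym : forall v w, form v w = form w v;
  cform_add : forall u v w, form (u + v) w = form u w + form v w;
  cform_scale : forall (c : F) v w,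
    form ((c%:A : uenv g) *: v) w = c * form v w;
  cform_contra : forall (u : uenv g) v w,
    form (u *: v) w = form v (tau u *: w)
}.

End Verma.

(* Main.v *)
(* Phi(u) denotes the v0-coefficient of u v0, where v0 generates M(lambda): it
   is the linear functional on U(g) with Phi(1) = 1, Phi(x u) = lam(x) Phi(u)
   for x in the opposite Borel subalgebra and Phi(u x) = lam(x) Phi(u) for x in
   b.  Its existence and uniqueness hold for every Lie algebra that is a sum of
   two subalgebras, with lam vanishing on the brackets of each: straightening
   (the diamond lemma behind the Poincare-Birkhoff-Witt theorem) extends the
   value prod_i lam(e_i) from sorted words in a basis to all words, consistently
   with the relations of U(g).  By uniqueness Phi o tau = Phi, so
   <u v0, w v0> = Phi(tau(u) w) is a well-defined contravariant form; and if
   <.,.>' is contravariant, then u |-> <v0, u v0>' satisfies the two equations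
   of Phi, hence is a multiple of it. *)
From HB Require Import structures.
Require Import Defs.
From mathcomp Require Import all_boot all_algebra.
From mathcomp Require Import zify ring.
From mathcomp Require Import boolp.
From mathcomp Require Import reals.
From mathcomp.real_closed Require Import complex.

Set Implicit Arguments.
Unset Strict Implicit.
Unset Printing Implicit Defensive.

Import GRing.Theory.
Local Open Scope ring_scope.

(** * Straightening of words *)

Section Words.
Variable n : nat.
Implicit Types u v w : seq 'I_n.

Fixpoint wt w : nat := if w is i :: w' then i * size w' + wt w' else 0.

(** The increment n t^2 + 1 from length t to length t + 1 exceeds every value of [wt] on words of
    length t. *)
Fixpoint wt_bound s : nat :=
  if s is t.+1 then (wt_bound t + n * t * t + 1)%N else 0.

(* Replacing a descent by the opposite pair lowers [wt]; shortening a word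
   lowers [wt_bound (size w)] by more than [wt] can increase. *)
Definition rank w : nat := wt_bound (size w) + wt w.

Lemma wt_le w : (wt w <= n * size w * size w)%N.
Proof.
elim: w => //= i w IH; have := ltn_ord i; move: (size w) (wt w) IH => s t.
nia.
Qed.

Lemma rank_size w w' : (size w' < size w)%N -> (rank w' < rank w)%N.
Proof.
rewrite /rank => ltss; have := wt_le w'; move: (size w') ltss (wt w') => s.
elim: (size w) => //= t IH; rewrite ltnS leq_eqVlt => /orP[/eqP-> | /IH{}IH] a.
  lia.
by move=> /IH; lia.
Qed.

Lemma rank_swap u (i j : 'I_n) v :
  (j < i)%N -> (rank (u ++ j :: i :: v) < rank (u ++ i :: j :: v))%N.
Proof.
move=> ltji; rewrite /rank !size_cat /= ltn_add2l.
elim: u => [|k u IH] /=; last by rewrite !size_cat /=; lia.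
by move: (size v) => s; nia.
Qed.

Lemma rank_merge u (i j k : 'I_n) v :
  (rank (u ++ k :: v) < rank (u ++ i :: j :: v))%N.
Proof. by apply: rank_size; rewrite !size_cat /= ltn_add2l. Qed.

(** The leftmost descent is singled out to make the rewriting deterministic; [nf_compatible] shows
    that any other descent would give the same value. *)
Fixpoint split_descent w : option (seq 'I_n * 'I_n * 'I_n * seq 'I_n) :=
  if w is i :: w' then
    if w' is j :: v then
      if (j < i)%N then Some ([::], i, j, v)
      else if split_descent w' is Some (u, a, b, v') then
        Some (i :: u, a, b, v')
      else None
    else None
  else None.

Lemma split_descentP w :
  if split_descent w is Some (u, i, j, v) then
    w = u ++ i :: j :: v /\ (j < i)%N
  else sorted (fun i j : 'I_n => (i <= j)%N) w.
Proof.
elim: w => // i [|j v] // IH.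
rewrite -[split_descent _]/(if (j < i)%N then Some ([::], i, j, v)
  else if split_descent (j :: v) is Some (u, a, b, v') then
    Some (i :: u, a, b, v') else None).
case: ltnP => // leij.
by case: split_descent IH => [[[[u a] b] v'] [-> ?]|/= ->]; rewrite ?leij.
Qed.

Lemma descent_split u (i j : 'I_n) v :
  (j < i)%N -> split_descent (u ++ i :: j :: v) != None.
Proof.
move=> ltji; have := split_descentP (u ++ i :: j :: v).
case: split_descent => // /cat_sorted2[_] /=.
by rewrite leqNgt ltji.
Qed.

(** Serves to locate two descents of one word relative to each other. *)
Lemma cat_eq_prefix (T : eqType) (u u' s s' : seq T) :
  u ++ s = u' ++ s' -> (size u <= size u')%N ->
  exists2 t, u' = u ++ t & s = t ++ s'.
Proof.
elim: u u' => [|a u IH] [|a' u'] //=; first by exists [::].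
  by move=> ->; exists (a' :: u').
by case=> -> /IH{}IH /IH[t -> ->]; exists t.
Qed.

End Words.

(** * Bilinearity, antisymmetry and the derivation form of the Jacobi identity *)

Section LieBilinear.
Variables (F : fieldType) (g : lieAlgType F).
Implicit Types x y z : g.

HB.instance Definition _ x :=
  GRing.isLinear.Build F g g *:%R (lie x) (lie_linearr x).

Lemma lieC x y : [lie x, y] = - [lie y, x].
Proof.
have D a b c : [lie a + b, c] = [lie a, c] + [lie b, c].
  by rewrite -[a]scale1r lie_linearl !scale1r.
apply/eqP; rewrite -addr_eq0; apply/eqP; have := lie_alt (x + y).
by rewrite D !linearD /= !lie_alt add0r addr0.
Qed.

Lemma lieDl x y z : [lie x + y, z] = [lie x, z] + [lie y, z].
Proof. by rewrite lieC linearD opprD -!lieC. Qed.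

Lemma lieZl c x y : [lie c *: x, y] = c *: [lie x, y].
Proof. by rewrite lieC linearZ /= -scalerN -lieC. Qed.

Lemma lie0l x : [lie 0, x] = 0.
Proof. by rewrite lieC linear0 oppr0. Qed.

Lemma lie_suml (I : Type) (r : seq I) (f : I -> g) y :
  [lie \sum_(i <- r) f i, y] = \sum_(i <- r) [lie f i, y].
Proof.
by rewrite lieC linear_sum -sumrN; apply: eq_bigr => i _; rewrite -lieC.
Qed.

Lemma lie_der x y z :
  [lie x, [lie y, z]] = [lie [lie x, y], z] + [lie y, [lie x, z]].
Proof.
have /eqP := lie_jacobi x y z; rewrite -addrA addr_eq0 => /eqP->.
by rewrite opprD addrC -lieC [[lie z, x]]lieC linearN opprK.
Qed.

End LieBilinear.

(** * Functions on words and the commutator rule *)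

Section Straightening.
Variables (F : fieldType) (g : lieAlgType F) (n : nat) (X : n.-tuple g).
Hypothesis X_basis : basis_of fullv X.
Implicit Types (u v w : seq 'I_n) (G : seq 'I_n -> F) (x y : g).

Let coordK x : x = \sum_i coord X i x *: X`_i.
Proof. by apply: coord_basis X_basis _; rewrite memvf. Qed.

(* The value of G, extended multilinearly, on the word u ++ x :: v. *)
Definition ins G u x v := \sum_k coord X k x * G (u ++ k :: v).

Lemma ins_linear G u v : scalar (fun x => ins G u x v).
Proof.
move=> a x y; rewrite /ins mulr_sumr -big_split; apply: eq_bigr => k _ /=.
by rewrite linearP mulrDl mulrA.
Qed.

Lemma insD G u x y v : ins G u (x + y) v = ins G u x v + ins G u y v.
Proof. by rewrite -[x]scale1r ins_linear mul1r scale1r. Qed.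

Lemma ins0 G u v : ins G u 0 v = 0.
Proof. by apply: big1 => k _; rewrite linear0 mul0r. Qed.

Lemma insN G u x v : ins G u (- x) v = - ins G u x v.
Proof. by apply/eqP; rewrite -addr_eq0 -insD addNr ins0. Qed.

Lemma insZ G u c x v : ins G u (c *: x) v = c * ins G u x v.
Proof. by rewrite -[c *: x]addr0 ins_linear ins0 addr0. Qed.

Lemma ins_sum G u v (I : Type) (r : seq I) (f : I -> g) :
  ins G u (\sum_(i <- r) f i) v = \sum_(i <- r) ins G u (f i) v.
Proof.
exact: (big_morph (fun x => ins G u x v)
  (fun x y => insD G u x y v) (ins0 G u v)).
Qed.

(** The relation x y = y x + [x, y] of U(g), as seen by G inside a word. A compatible G is a linear
    functional on U(g), recorded by its values on words. *)
Definition swap_rule G u (i j : 'I_n) v :=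
  G (u ++ i :: j :: v) = G (u ++ j :: i :: v) + ins G u [lie X`_i, X`_j] v.

Definition compatible G := forall u i j v, swap_rule G u i j v.

Lemma swap_rule_sym G u i j v : swap_rule G u i j v -> swap_rule G u j i v.
Proof. by rewrite /swap_rule => ->; rewrite [[lie X`_j, _]]lieC insN addrK. Qed.

Lemma swap_rule_refl G u i v : swap_rule G u i i v.
Proof. by rewrite /swap_rule lie_alt ins0 addr0. Qed.

Lemma ins_swap G u x k v :
    (forall i, swap_rule G u i k v) ->
  ins G u x (k :: v) = ins G (rcons u k) x v + ins G u [lie x, X`_k] v.
Proof.
move=> Guk; rewrite {3}[x]coordK lie_suml ins_sum -big_split /=.
by apply: eq_bigr => i _; rewrite Guk cat_rcons lieZl insZ mulrDr.
Qed.

(** * Extension of a function from sorted words to all words *)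

Section NormalForm.
Variable f : seq 'I_n -> F.

(** Fuel stands in for well-founded recursion on [rank]. The default 0 is never reached once d is at
    least [rank w], since both kinds of recursive call lower the rank. *)
Fixpoint nf_fuel d w : F :=
  if split_descent w is Some (u, i, j, v) then
    if d is d'.+1 then
      nf_fuel d' (u ++ j :: i :: v) + ins (nf_fuel d') u [lie X`_i, X`_j] v
    else 0
  else f w.

Definition nf w := nf_fuel (rank w) w.

Lemma nf_fuelE d w : (rank w <= d)%N -> nf_fuel d w = nf w.
Proof.
rewrite /nf; suff nf_eq d1 d2 : (rank w <= d1)%N -> (rank w <= d2)%N ->
  nf_fuel d1 w = nf_fuel d2 w by move=> le; apply: nf_eq.
elim: d1 d2 w {d} => [|d1 IH] d2 w le1 le2.
  case: d2 {le2} => [//|d2] /=; have := split_descentP w.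
  case: split_descent => // [[[[u i] j] v] [ew ltji]].
  by have := rank_swap u v ltji; rewrite -ew ltnNge; case: ltngtP le1; lia.
have := split_descentP w; case: d2 le2 => [|d2] /= le2.
  case: split_descent => // [[[[u i] j] v] [ew ltji]].
  by have := rank_swap u v ltji; rewrite -ew; lia.
case: split_descent => // [[[[u i] j] v] [ew ltji]].
have := rank_swap u v ltji; rewrite -ew => lts; congr (_ + _).
  by apply: IH; lia.
apply: eq_bigr => k _; congr (_ * _); have := rank_merge u i j k v.
by rewrite -ew => ltm; apply: IH; rewrite -ltnS (leq_trans ltm).
Qed.

Lemma nfE w :
  nf w = if split_descent w is Some (u, i, j, v) then
           nf (u ++ j :: i :: v) + ins nf u [lie X`_i, X`_j] v
         else f w.
Proof.
rewrite {1}/nf; have := split_descentP w; case rw: (rank w) => [|r] /=;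
  case: split_descent => // [[[[u i] j] v] [ew ltji]];
  have := rank_swap u v ltji; rewrite -ew rw // => lts; congr (_ + _).
  by rewrite nf_fuelE // -ltnS.
apply: eq_bigr => k _; congr (_ * _); have := rank_merge u i j k v.
by rewrite -ew rw ltnS => ltm; rewrite nf_fuelE.
Qed.

Lemma nf_sorted w : sorted (fun i j : 'I_n => (i <= j)%N) w -> nf w = f w.
Proof.
rewrite nfE; have := split_descentP w; case: split_descent => //.
move=> [[[u i] j] v] [-> ltji] /cat_sorted2[_] /=.
by rewrite leqNgt ltji.
Qed.

(** * Local confluence, by induction on the rank *)

Section Confluence.
Variable w0 : seq 'I_n.
Hypothesis IH : forall u (i j : 'I_n) v,
  (rank (u ++ i :: j :: v) < rank w0)%N -> (j < i)%N -> swap_rule nf u i j v.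

(** A shorter word has smaller rank whatever the order of its letters, so the rule is available
    there at every adjacent pair and not only at descents. *)
Let IHsize u i j v :
  (size (u ++ i :: j :: v) < size w0)%N -> swap_rule nf u i j v.
Proof.
move=> lts; have ltr := rank_size lts.
case: (ltngtP i j) => [ltij|ltji|/val_inj->]; last exact: swap_rule_refl.
  by apply/swap_rule_sym/IH => //; apply: rank_size; rewrite !size_cat in lts *.
exact: IH.
Qed.

Let ins_comm u x k v :
    (size u + size v + 2 < size w0)%N ->
  ins nf u x (k :: v) = ins nf (rcons u k) x v + ins nf u [lie x, X`_k] v.
Proof.
by move=> lts; apply: ins_swap => i; apply: IHsize; rewrite size_cat /=; lia.
Qed.

(* The two ways of sorting a decreasing triple differ by a Jacobi sum. *)
Lemma confluence_overlap u (i j k : 'I_n) v :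
    w0 = u ++ i :: j :: k :: v -> (j < i)%N -> (k < j)%N ->
  nf (u ++ j :: i :: k :: v) + ins nf u [lie X`_i, X`_j] (k :: v) =
  nf (u ++ i :: k :: j :: v) + ins nf (rcons u i) [lie X`_j, X`_k] v.
Proof.
move=> ew ltji ltkj; have ltki := ltn_trans ltkj ltji.
have sw : size w0 = (size u + size v + 3)%N by rewrite ew size_cat /=; lia.
have r1 : (rank (u ++ j :: i :: k :: v) < rank w0)%N by rewrite ew rank_swap.
have r2 : (rank (u ++ j :: k :: i :: v) < rank w0)%N.
  by apply: ltn_trans r1; rewrite -!(cat_rcons j) rank_swap.
have r3 : (rank (u ++ i :: k :: j :: v) < rank w0)%N.
  by rewrite ew -!(cat_rcons i) rank_swap.
have r4 : (rank (u ++ k :: i :: j :: v) < rank w0)%N.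
  by apply: ltn_trans r3; rewrite rank_swap.
have e1 : nf (u ++ j :: i :: k :: v)
          = nf (u ++ j :: k :: i :: v) + ins nf (rcons u j) [lie X`_i, X`_k] v.
  by rewrite -!(cat_rcons j); apply: IH; rewrite ?cat_rcons.
have e2 : nf (u ++ j :: k :: i :: v)
          = nf (u ++ k :: j :: i :: v) + ins nf u [lie X`_j, X`_k] (i :: v).
  exact: IH.
have e3 : nf (u ++ i :: k :: j :: v)
          = nf (u ++ k :: i :: j :: v) + ins nf u [lie X`_i, X`_k] (j :: v).
  exact: IH.
have e4 : nf (u ++ k :: i :: j :: v)
          = nf (u ++ k :: j :: i :: v) + ins nf (rcons u k) [lie X`_i, X`_j] v.
  by rewrite -!(cat_rcons k); apply: IH; rewrite ?cat_rcons.
rewrite e1 e2 e3 e4 !ins_comm ?sw; try lia.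
(* Both sides now share the word u k j i v and the same single brackets; the double brackets that
   remain balance by the Jacobi identity. *)
have -> : [lie [lie X`_i, X`_k], X`_j] =
          [lie [lie X`_i, X`_j], X`_k] + [lie [lie X`_j, X`_k], X`_i].
  rewrite [[lie [lie X`_j, _], _]]lieC [[lie [lie X`_i, X`_k], _]]lieC.
  rewrite [[lie X`_i, [lie X`_j, X`_k]]]lie_der.
  by rewrite opprD addrA subrr add0r.
rewrite insD; ring.
Qed.

(** The two swaps act on different letters. Performing both in either order leads to the same word,
    the same single-bracket terms and the same double sum with both brackets inserted. *)
Lemma confluence_disjoint u (i j : 'I_n) t (k l : 'I_n) v :
    w0 = u ++ i :: j :: t ++ k :: l :: v -> (j < i)%N -> (l < k)%N ->
  nf (u ++ j :: i :: t ++ k :: l :: v)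
    + ins nf u [lie X`_i, X`_j] (t ++ k :: l :: v) =
  nf (u ++ i :: j :: t ++ l :: k :: v)
    + ins nf (u ++ i :: j :: t) [lie X`_k, X`_l] v.
Proof.
move=> ew ltji ltlk.
have sw : size w0 = (size u + size t + size v + 4)%N.
  by rewrite ew !size_cat /= ?size_cat /= ?size_cat /=; lia.
have cA a b s : u ++ a :: b :: t ++ s = (u ++ a :: b :: t) ++ s.
  by rewrite -catA.
have r1 : (rank (u ++ j :: i :: t ++ k :: l :: v) < rank w0)%N.
  by rewrite ew rank_swap.
have r2 : (rank (u ++ i :: j :: t ++ l :: k :: v) < rank w0)%N.
  by rewrite ew !cA rank_swap.
have -> : nf (u ++ j :: i :: t ++ k :: l :: v)
          = nf (u ++ j :: i :: t ++ l :: k :: v)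
            + ins nf (u ++ j :: i :: t) [lie X`_k, X`_l] v.
  by rewrite !cA; apply: IH; rewrite // -cA.
have -> : nf (u ++ i :: j :: t ++ l :: k :: v)
          = nf (u ++ j :: i :: t ++ l :: k :: v)
            + ins nf u [lie X`_i, X`_j] (t ++ l :: k :: v).
  exact: IH.
rewrite -!addrA; congr (_ + _).
pose ca p := coord X p [lie X`_i, X`_j].
pose cb q := coord X q [lie X`_k, X`_l].
have -> : ins nf u [lie X`_i, X`_j] (t ++ k :: l :: v)
    = ins nf u [lie X`_i, X`_j] (t ++ l :: k :: v)
      + \sum_p \sum_q ca p * (cb q * nf (u ++ p :: t ++ q :: v)).
  rewrite /ins -big_split /=; apply: eq_bigr => p _.
  have := @IHsize (u ++ p :: t) k l v; rewrite /swap_rule -!catA /= => ->.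
    rewrite mulrDr mulr_sumr; congr (_ + _).
    by apply: eq_bigr => q _; rewrite -catA.
  by rewrite !size_cat /= ?size_cat /= ?size_cat /= sw; lia.
have -> : ins nf (u ++ i :: j :: t) [lie X`_k, X`_l] v
    = ins nf (u ++ j :: i :: t) [lie X`_k, X`_l] v
      + \sum_p \sum_q ca p * (cb q * nf (u ++ p :: t ++ q :: v)).
  rewrite exchange_big /= /ins -big_split /=; apply: eq_bigr => q _.
  rewrite -!catA /=.
  have := @IHsize u i j (t ++ q :: v); rewrite /swap_rule => ->.
    rewrite mulrDr mulr_sumr; congr (_ + _).
    by apply: eq_bigr => p _; rewrite mulrCA.
  by rewrite !size_cat /= ?size_cat /= ?size_cat /= sw; lia.
by rewrite addrCA.
Qed.

(** The second descent starts either one letter after the first, which is the overlap, or at least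
    two letters after it, which is the disjoint case. *)
Lemma confluence_lt u (i j : 'I_n) v u' (i' j' : 'I_n) v' :
    w0 = u ++ i :: j :: v -> w0 = u' ++ i' :: j' :: v' ->
    (j < i)%N -> (j' < i')%N -> (size u < size u')%N ->
  nf (u ++ j :: i :: v) + ins nf u [lie X`_i, X`_j] v =
  nf (u' ++ j' :: i' :: v') + ins nf u' [lie X`_i', X`_j'] v'.
Proof.
move=> ew ew' ltji ltji' ltuu'.
have ee : u ++ i :: j :: v = u' ++ i' :: j' :: v'.
  by rewrite -ew.
have [[|a [|b t]] eu' /=] := cat_eq_prefix ee (ltnW ltuu').
- by move: ltuu'; rewrite eu' cats0 ltnn.
- case=> ea ei ev; rewrite eu' -ea cats1 ev -ei cat_rcons.
  by apply: confluence_overlap => //; [rewrite ew ev | rewrite ei].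
- case=> ea eb ev; rewrite eu' -ea -eb -!catA ev.
  by apply: confluence_disjoint => //; rewrite ew ev.
Qed.

End Confluence.

(** The rule holds at the leftmost descent by construction, and confluence carries it to every other
    descent by induction on the rank. Ascents follow by antisymmetry of the bracket, equal letters
    from [x, x] = 0. *)
Lemma nf_compatible : compatible nf.
Proof.
have nf_desc r u (i j : 'I_n) v :
    (rank (u ++ i :: j :: v) < r)%N -> (j < i)%N -> swap_rule nf u i j v.
  elim: r u i j v => // r IHr u i j v ltr ltji; rewrite /swap_rule nfE.
  have := descent_split u v ltji; have := split_descentP (u ++ i :: j :: v).
  case: split_descent => // [[[[u' i'] j'] v'] [ew' ltji'] _].
  have IH t (a b : 'I_n) s :
      (rank (t ++ a :: b :: s) < rank (u ++ i :: j :: v))%N -> (b < a)%N ->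
    swap_rule nf t a b s by move=> lt1; apply: IHr; lia.
  have [lt1|lt1|eq1] := ltngtP (size u) (size u').
  - exact/esym/(confluence_lt IH).
  - exact: (confluence_lt IH).
  - by have /eqP := ew'; rewrite eqseq_cat // => /andP[/eqP-> /eqP[-> -> ->]].
move=> u i j v; case: (ltngtP i j) => [ltij|ltji|/val_inj->].
- exact/swap_rule_sym/(@nf_desc _ _ _ _ _ (ltnSn _)).
- exact: (@nf_desc _ _ _ _ _ (ltnSn _)).
- exact: swap_rule_refl.
Qed.

End NormalForm.

End Straightening.

Section ScalarFunctions.
Variables (F : fieldType) (V : lmodType F) (f : V -> F).
Hypothesis f_scalar : scalar f.

Lemma scalarfD x y : f (x + y) = f x + f y.
Proof. by rewrite -[x]scale1r f_scalar mul1r scale1r. Qed.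

Lemma scalarf0 : f 0 = 0.
Proof. by apply: (addrI (f 0)); rewrite -scalarfD !addr0. Qed.

Lemma scalarfZ c x : f (c *: x) = c * f x.
Proof. by rewrite -[c *: x]addr0 f_scalar scalarf0 addr0. Qed.

Lemma scalarf_sum (I : Type) (r : seq I) (h : I -> V) :
  f (\sum_(i <- r) h i) = \sum_(i <- r) f (h i).
Proof. exact: (big_morph f scalarfD scalarf0). Qed.

End ScalarFunctions.

(** * Functions on words with prescribed left and right characters *)

Section WordFunctionals.
Variables (F : fieldType) (g : lieAlgType F) (n : nat) (X : n.-tuple g).
Hypothesis X_basis : basis_of fullv X.
Implicit Types (u v w : seq 'I_n) (G : seq 'I_n -> F) (x y : g).

Let coordK x : x = \sum_i coord X i x *: X`_i.
Proof. by apply: coord_basis X_basis _; rewrite memvf. Qed.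

Variables (lam : g -> F) (p q : nat).
Hypothesis lam_scalar : scalar lam.

Let lamE x : lam x = \sum_i coord X i x * lam X`_i.
Proof.
rewrite {1}[x]coordK scalarf_sum //.
by apply: eq_bigr => i _; rewrite scalarfZ.
Qed.

Section Existence.
Hypothesis lam_left : forall i j : 'I_n, (i < q)%N -> (j < q)%N ->
  lam [lie X`_i, X`_j] = 0.
Hypothesis closed_left : forall i j k : 'I_n,
  (i < q)%N -> (j < q)%N -> (q <= k)%N -> coord X k [lie X`_i, X`_j] = 0.
Hypothesis lam_right : forall i j : 'I_n, (p <= i)%N -> (p <= j)%N ->
  lam [lie X`_i, X`_j] = 0.
Hypothesis closed_right : forall i j k : 'I_n,
  (p <= i)%N -> (p <= j)%N -> (k < p)%N -> coord X k [lie X`_i, X`_j] = 0.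

(** In the application the letters below [q] form a basis of one subalgebra and the letters from [p]
    on a basis of the other. *)
Definition char_nf := nf X (fun w => \prod_(i <- w) lam X`_i).

Lemma char_nf_compatible : compatible X char_nf.
Proof. exact: nf_compatible. Qed.

Lemma char_nf_nil : char_nf [::] = 1.
Proof. by rewrite /char_nf nf_sorted // big_nil. Qed.

(** Induction on the rank. A descent at the head pairs i with a smaller letter, again below q; the
    bracket then expands in letters below q and contributes a multiple of [lam] of a bracket, which
    is 0. A descent further right is resolved behind i. *)
Lemma char_nf_cons (i : 'I_n) w :
  (i < q)%N -> char_nf (i :: w) = lam X`_i * char_nf w.
Proof.
have [r] := ubnP (rank (i :: w)).
elim: r i w => // r IH i w; rewrite ltnS => ltr ltiq.
have := split_descentP (i :: w).
case: split_descent => [[[[u a] b] v]|]; last first.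
  move=> siw; have /= /path_sorted sw := siw.
  by rewrite /char_nf !nf_sorted // big_cons.
case: u => [|c u] /= [[ei ew] ltba].
  rewrite -ei in ltba; have ltbq := ltn_trans ltba ltiq.
  have := char_nf_compatible [::] i b v; rewrite /swap_rule ew /= => ->.
  have lt1 : (rank (b :: i :: v) < r)%N.
    by rewrite ew in ltr; apply: leq_trans ltr; apply: (@rank_swap _ [::]).
  have shorter (t : seq 'I_n) : (size t < size (i :: w))%N -> (rank t < r)%N.
    by move=> lts; apply: leq_trans (rank_size lts) ltr.
  rewrite !(IH _ _ _ ltbq) ?(IH _ _ _ ltiq) //; try by apply: shorter; rewrite ew.
  rewrite mulrCA -[RHS]addr0; congr (_ + _).
  rewrite -[RHS](mul0r (char_nf v)) -(lam_left ltiq ltbq) lamE.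
  rewrite mulr_suml; apply: eq_bigr => k _; rewrite -mulrA.
  case: (ltnP k q) => [ltkq|leqk]; last by rewrite closed_left ?mul0r.
  by rewrite IH //; apply: shorter; rewrite ew.
have := char_nf_compatible (i :: u) a b v; rewrite /swap_rule /= -ew => ->.
rewrite ew (char_nf_compatible u a b v).
have lt1 : (rank (i :: u ++ b :: a :: v) < r)%N.
  by apply: leq_trans ltr; rewrite ew; apply: (rank_swap (i :: u)).
rewrite IH // mulrDr /ins mulr_sumr; congr (_ + _); apply: eq_bigr => k _.
rewrite (IH i (u ++ k :: v)) => [||//]; first exact: mulrCA.
by apply: leq_trans ltr; rewrite ew; apply: (rank_merge (i :: u)).
Qed.

(** Mirror image of [char_nf_cons]: a descent at the end pairs i with a larger letter, which is
    again at least p. *)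
Lemma char_nf_rcons (i : 'I_n) w :
  (p <= i)%N -> char_nf (rcons w i) = lam X`_i * char_nf w.
Proof.
have [r] := ubnP (rank (rcons w i)).
elim: r i w => // r IH i w; rewrite ltnS => ltr lepi.
have := split_descentP (rcons w i).
case: split_descent => [[[[u a] b] v]|]; last first.
  rewrite -cats1 => siw; have [sw _] := cat_sorted2 siw.
  by rewrite /char_nf !nf_sorted // big_cat big_seq1 mulrC.
case/lastP: v => [|v c].
  rewrite -cat_rcons cats1 => -[/rcons_inj[ew <-] ltia].
  have lepa := leq_trans lepi (ltnW ltia).
  have := char_nf_compatible u a i [::]; rewrite /swap_rule.
  rewrite -!(cat_rcons _ u) !cats1 ew => ->.
  have shorter (t : seq 'I_n) :
      (size t < size (rcons w i))%N -> (rank t < r)%N.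
    by move=> lts; apply: leq_trans (rank_size lts) ltr.
  rewrite ew in ltr shorter.
  have lt1 : (rank (rcons (rcons u i) a) < r)%N.
    apply: leq_trans ltr; rewrite -!cats1 -!catA; exact: rank_swap.
  rewrite !IH //; try by apply: shorter; rewrite !size_rcons.
  rewrite mulrCA -[RHS]addr0; congr (_ + _).
  rewrite -[RHS](mul0r (char_nf u)) -(lam_right lepa lepi) lamE.
  rewrite mulr_suml; apply: eq_bigr => k _; rewrite -mulrA cats1.
  case: (leqP p k) => [lepk|ltkp]; last by rewrite closed_right ?mul0r.
  by rewrite IH //; apply: shorter; rewrite !size_rcons.
rewrite -!rcons_cons -rcons_cat => -[/rcons_inj[ew _] ltba].
have := char_nf_compatible u a b (rcons v i); rewrite /swap_rule.
rewrite -!rcons_cons -!rcons_cat -ew => ->.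
rewrite ew (char_nf_compatible u a b v).
have lt1 : (rank (rcons (u ++ b :: a :: v) i) < r)%N.
  by apply: leq_trans ltr; rewrite ew !rcons_cat; apply: rank_swap.
rewrite IH // mulrDr /ins mulr_sumr; congr (_ + _); apply: eq_bigr => k _.
rewrite -rcons_cons -rcons_cat (IH i (u ++ k :: v)) => [||//].
  exact: mulrCA.
by apply: leq_trans ltr; rewrite ew !rcons_cat; apply: rank_merge.
Qed.

End Existence.

(** The swap rule reduces to sorted words. A nonempty sorted word either starts with a letter below
    q, which factors out on the left, or has all its letters at least q, hence at least p, and its
    last letter factors out on the right. *)
Lemma two_sided_eq0 G :
    (p <= q)%N -> compatible X G -> G [::] = 0 ->
    (forall (i : 'I_n) w, (i < q)%N -> G (i :: w) = lam X`_i * G w) ->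
    (forall (i : 'I_n) w, (p <= i)%N -> G (rcons w i) = lam X`_i * G w) ->
  forall w, G w = 0.
Proof.
move=> lepq Gcomp G0 Gl Gr w.
have [r] := ubnP (rank w); elim: r w => // r IH w; rewrite ltnS => ltr.
have := split_descentP w; case: split_descent => [[[[u a] b] v] [ew ltba]|].
  rewrite ew Gcomp IH ?add0r; last first.
    by apply: leq_trans ltr; rewrite ew; apply: rank_swap.
  apply: big1 => k _; rewrite IH ?mulr0 //; apply: leq_trans ltr.
  by rewrite ew; apply: rank_merge.
have shorter t : (size t < size w)%N -> G t = 0.
  by move=> lts; apply: IH; apply: leq_trans (rank_size lts) ltr.
case: w ltr shorter => // i w _ shorter siw.
case: (ltnP i q) => [ltiq|leqi]; first by rewrite Gl // shorter ?mulr0.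
have leij : (i <= last i w)%N.
  have /allP min_i : all (fun j : 'I_n => (i <= j)%N) w.
    by apply: order_path_min siw => ? ? ?; apply: leq_trans.
  by case/lastP: w min_i {shorter siw} => [|w j] // /(_ j);
    rewrite last_rcons mem_rcons mem_head; apply.
rewrite lastI Gr ?shorter ?mulr0 // ?size_belast //.
exact: leq_trans lepq (leq_trans leqi leij).
Qed.

End WordFunctionals.

(** * Functionals on the enveloping algebra *)

Section WordAction.
Variables (F : fieldType) (g : lieAlgType F) (n : nat) (X : n.-tuple g).
Hypothesis X_basis : basis_of fullv X.
Implicit Types (u v w : seq 'I_n) (G H : seq 'I_n -> F) (x y : g).
Implicit Types s t : uterm g.

Let coordK x : x = \sum_i coord X i x *: X`_i.
Proof. by apply: coord_basis X_basis _; rewrite memvf. Qed.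

(* Right translation: if G is the functional w |-> Phi(w), then [uact s G] is
   w |-> Phi(w s). *)
Fixpoint uact s G w : F :=
  match s with
  | UCst c => c * G w
  | UGen x => ins X G w x [::]
  | UAdd s t => uact s G w + uact t G w
  | UMul s t => uact s (uact t G) w
  end.

Lemma uact_linear s a G H w :
  uact s (fun v => a * G v + H v) w = a * uact s G w + uact s H w.
Proof.
elim: s G H w => [c|x|s IHs t IHt|s IHs t IHt] G H w /=.
- by rewrite mulrDr mulrCA.
- rewrite /ins mulr_sumr -big_split; apply: eq_bigr => k _ /=.
  by rewrite mulrDr mulrCA.
- by rewrite IHs IHt mulrDr addrACA.
- by rewrite -IHs; congr uact; apply/funext => v; rewrite IHt.
Qed.

Lemma uactZ s a G w : uact s (fun v => a * G v) w = a * uact s G w.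
Proof.
elim: s G w => [c|x|s IHs t IHt|s IHs t IHt] G w /=.
- by rewrite mulrCA.
- by rewrite /ins mulr_sumr; apply: eq_bigr => k _; rewrite mulrCA.
- by rewrite IHs IHt mulrDr.
- by rewrite -IHs; congr uact; apply/funext => v; rewrite IHt.
Qed.

(** Needed for products: the first factor acts on the function already translated by the second,
    which must again be compatible. *)
Lemma uact_compatible s G : compatible X G -> compatible X (uact s G).
Proof.
elim: s G => [c|x|s IHs t IHt|s IHs t IHt] G Gcomp u i j v;
  rewrite /swap_rule /=.
- rewrite Gcomp mulrDr /ins mulr_sumr; congr (_ + _).
  by apply: eq_bigr => k _; rewrite mulrCA.
- rewrite /ins; under [X in _ = _ + X]eq_bigr do rewrite mulr_sumr.
  rewrite exchange_big -big_split; apply: eq_bigr => k _ /=.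
  rewrite -!catA /= Gcomp mulrDr /ins mulr_sumr; congr (_ + _).
  by apply: eq_bigr => l _; rewrite mulrCA -catA.
- rewrite IHs // IHt // addrACA; congr (_ + _).
  by rewrite /ins -big_split; apply: eq_bigr => k _; rewrite mulrDr.
- by rewrite IHs //; apply: IHt.
Qed.

(** The swap rule, given for letters, extends bilinearly to two arbitrary elements of g. *)
Lemma ins_lie G x y v w : compatible X G ->
  \sum_k \sum_l coord X k x * (coord X l y * G (w ++ k :: l :: v)) =
  \sum_k \sum_l coord X k x * (coord X l y * G (w ++ l :: k :: v))
    + ins X G w [lie x, y] v.
Proof.
move=> Gcomp; rewrite {3}[x]coordK lie_suml ins_sum -big_split.
apply: eq_bigr => k _ /=; rewrite {3}[y]coordK linear_sum ins_sum -big_split.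
apply: eq_bigr => l _ /=; rewrite lieZl linearZ !insZ Gcomp.
by rewrite !mulrDr.
Qed.

(** Translation thus descends from terms to U(g). The commutator relation is where the swap rule
    enters; the other generating relations are linear algebra. *)
Lemma uact_cong s t G : ucong s t -> compatible X G -> uact s G = uact t G.
Proof.
move=> st; elim: st G => //.
- by move=> ? ? _ IH G /IH.
- by move=> ? ? ? _ IH1 _ IH2 G Gc; rewrite IH1 ?IH2.
- by move=> ? ? ? ? _ IH1 _ IH2 G Gc; apply/funext => w /=; rewrite IH1 ?IH2.
- move=> ? ? ? ? _ IH1 _ IH2 G Gc; apply/funext => w /=.
  by rewrite IH2 // IH1 //; apply: uact_compatible.
- by move=> *; apply/funext => w /=; rewrite addrA.
- by move=> *; apply/funext => w /=; rewrite addrC.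
- by move=> *; apply/funext => w /=; rewrite mul0r add0r.
- by move=> *; apply/funext => w /=; rewrite mulN1r addNr mul0r.
- by move=> *; apply/funext => w /=; rewrite mul1r.
- move=> s0 G Gc; apply/funext => w /=; rewrite -[RHS]mul1r -uactZ.
  by [].
- move=> s0 t0 u0 G Gc; apply/funext => w /=.
  rewrite -[X in X + _]mul1r -uact_linear.
  by congr uact; apply/funext => v; rewrite mul1r.
- by move=> *; apply/funext => w /=; rewrite mulrDl.
- by move=> *; apply/funext => w /=; rewrite mulrA.
- by move=> c s0 G Gc; apply/funext => w /=; rewrite uactZ.
- by move=> *; apply/funext => w /=; rewrite insD.
- by move=> *; apply/funext => w /=; rewrite insZ.
- move=> x y G Gc; apply/funext => w /=.
  have := ins_lie x y [::] w Gc.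
  have E a b : \sum_k \sum_l coord X k a * (coord X l b * G (w ++ [:: k; l])) =
      ins X (fun v => ins X G v b [::]) w a [::].
    rewrite /ins; apply: eq_bigr => k _; rewrite mulr_sumr.
    by apply: eq_bigr => l _; rewrite -catA.
  rewrite E => ->; congr (_ + _); rewrite -E exchange_big /=.
  by apply: eq_bigr => k _; apply: eq_bigr => l _; rewrite mulrCA.
Qed.

(** Translation on the right commutes with prefixing a letter on the left. *)
Lemma uact_cons s G i c :
    (forall w, G (i :: w) = c * G w) ->
  forall w, uact s G (i :: w) = c * uact s G w.
Proof.
elim: s G => [d|x|s IHs t IHt|s IHs t IHt] G Gi w /=.
- by rewrite Gi mulrCA.
- by rewrite /ins mulr_sumr; apply: eq_bigr => k _; rewrite cat_cons Gi mulrCA.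
- by rewrite IHs // IHt // mulrDr.
- by apply: IHs; apply: IHt.
Qed.

End WordAction.

(** * Words as elements of the enveloping algebra *)

Section WordSpan.
Variables (F : fieldType) (g : lieAlgType F) (n : nat) (X : n.-tuple g).
Hypothesis X_basis : basis_of fullv X.

Lemma uinjD (x y : g) : uinj (x + y) = uinj x + uinj y.
Proof. by have := (uinj_lie_morphism g).1 1 x y; rewrite !scale1r. Qed.

Lemma uinj0 : uinj (0 : g) = 0.
Proof. by apply: (addrI (uinj 0)); rewrite -uinjD !addr0. Qed.

Lemma uinjZ c (x : g) : uinj (c *: x) = c *: uinj x.
Proof. by rewrite -[c *: x]addr0 (uinj_lie_morphism g).1 uinj0 addr0. Qed.

Lemma uinj_sum (I : Type) (r : seq I) (f : I -> g) :
  uinj (\sum_(i <- r) f i) = \sum_(i <- r) uinj (f i).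
Proof. exact: (big_morph _ uinjD uinj0). Qed.

Definition uword (w : seq 'I_n) : uenv g := \prod_(i <- w) uinj X`_i.

Let coordK x : x = \sum_i coord X i x *: X`_i.
Proof. by apply: coord_basis X_basis _; rewrite memvf. Qed.

(** Words span U(g). The induction runs over all functionals at once: for a product s t, first t is
    replaced by words with s fixed, then s with the word on its right fixed. *)
Lemma scalar_uword0 (D : uenv g -> F) :
  scalar D -> (forall w, D (uword w) = 0) -> forall u, D u = 0.
Proof.
move=> Dlin D0; elim/uenv_ind=> s.
elim: s D Dlin D0 => [c|x|s IHs t IHt|s IHs t IHt] D Dlin D0.
- rewrite -[upi _]/(ucst g c) ucstE scalarfZ //.
  by have := D0 [::]; rewrite /uword big_nil => ->; rewrite mulr0.
- rewrite -[upi _]/(uinj x) [x]coordK uinj_sum scalarf_sum // big1 // => k _.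
  rewrite uinjZ scalarfZ //; have := D0 [:: k].
  by rewrite /uword big_seq1 => ->; rewrite mulr0.
- have -> : upi (UAdd s t) = upi s + upi t := upi_add s t.
  rewrite scalarfD //.
  by rewrite IHs // IHt // addr0.
- have -> : upi (UMul s t) = upi s * upi t := upi_mul s t.
  apply: (IHt (fun u => D (upi s * u))) => [a x y|w].
    by rewrite mulrDr -scalerAr Dlin.
  apply: (IHs (fun u => D (u * uword w))) => [a x y|v].
    by rewrite mulrDl -scalerAl Dlin.
  by rewrite /uword -big_cat D0.
Qed.

Lemma uword_compatible (D : uenv g -> F) :
  scalar D -> compatible X (fun w => D (uword w)).
Proof.
move=> Dlin u i j v; rewrite /swap_rule /ins.
have E w : D (uword (u ++ w)) = D (uword u * uword w) by rewrite /uword big_cat.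
under eq_bigr do rewrite E -(scalarfZ Dlin).
rewrite !E -(scalarf_sum Dlin) -(scalarfD Dlin); congr D.
have C (k : 'I_n) w : uword (k :: w) = uinj X`_k * uword w.
  by rewrite /uword big_cons.
rewrite !C; under eq_bigr do rewrite C scalerAr.
rewrite -mulr_sumr -mulrDr; congr (_ * _).
under eq_bigr do rewrite scalerAl; rewrite -mulr_suml !mulrA -mulrDl.
congr (_ * _); under eq_bigr do rewrite -uinjZ; rewrite -uinj_sum -coordK.
by rewrite (uinj_lie_morphism g).2 addrC subrK.
Qed.

End WordSpan.

Lemma span_memP (F : fieldType) (V : vectType F) (P : V -> Prop) (s : seq V) :
    P 0 -> (forall a x y, P x -> P y -> P (a *: x + y)) ->
    (forall x, x \in s -> P x) ->
  forall x, x \in <<s>>%VS -> P x.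
Proof.
move=> P0 PD Ps x /(@coord_span _ _ _ (in_tuple s)) ->.
apply: big_ind => // [y z Py Pz|i _]; first by rewrite -[y]scale1r; apply: PD.
by rewrite -[_ *: _]addr0; apply: PD => //; apply: Ps; rewrite mem_nth.
Qed.

(** * Characters on a sum of two subalgebras *)

Section TwoSided.
Variables (F : fieldType) (g : lieAlgType F).
Implicit Types (bm bp : {vspace g}) (lam : g -> F) (Phi : uenv g -> F).

Definition left_char bm lam Phi :=
  forall x u, x \in bm -> Phi (uinj x * u) = lam x * Phi u.

Definition right_char bp lam Phi :=
  forall x u, x \in bp -> Phi (u * uinj x) = lam x * Phi u.

(** The basis lists a complement A of the intersection in [bm], then a basis B of the intersection,
    then a complement C in [bp]. Indices from p up to q are those of the intersection. *)
Lemma adapted_basis bm bp : (bm + bp)%VS = fullv ->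
  exists (n p q : nat) (X : n.-tuple g),
    [/\ basis_of fullv X, (p <= q)%N,
        forall i : 'I_n, (i < q)%N -> X`_i \in bm,
        forall i : 'I_n, (p <= i)%N -> X`_i \in bp &
        (forall x (k : 'I_n), x \in bm -> (q <= k)%N -> coord X k x = 0) /\
        (forall x (k : 'I_n), x \in bp -> (k < p)%N -> coord X k x = 0)].
Proof.
move=> bmp; pose A := vbasis (bm :\: bp); pose B := vbasis (bm :&: bp).
pose C := vbasis (bp :\: bm); pose s := A ++ B ++ C.
have eC : (bp :\: bm + bm :&: bp)%VS = bp by rewrite capvC addv_diff_cap.
have bBC : basis_of bp (B ++ C).
  rewrite -{1}eC addvC; apply: cat_basis; rewrite ?vbasisP //.
  apply/directv_addP/eqP; rewrite -subv0 -(capv_diff bp bm) subv_cap capvSr /=.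
  by apply: subv_trans (capvSl _ _) (capvSl _ _).
have bX : basis_of fullv s.
  rewrite -{1}bmp -{1}addv_diff; apply: cat_basis; rewrite ?vbasisP //.
  by apply/directv_addP; rewrite capv_diff.
have bAB : basis_of bm (A ++ B).
  rewrite -{1}(addv_diff_cap bm bp); apply: cat_basis; rewrite ?vbasisP //.
  apply/directv_addP/eqP; rewrite -subv0 -(capv_diff bm bp).
  by rewrite subv_cap capvSl /= (subv_trans (capvSr _ _) (capvSr _ _)).
have nthAB j : (j < size (A ++ B))%N -> s`_j = (A ++ B)`_j.
  by move=> ltj; rewrite /s catA nth_cat ltj.
have nthBC j : (size A <= j)%N -> s`_j = (B ++ C)`_(j - size A).
  by move=> lej; rewrite /s nth_cat ltnNge lej.
have coord0 x (k : 'I_(size s)) (t : seq g) : x \in <<t>>%VS ->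
    (forall y, y \in t -> exists2 j : 'I_(size s), j != k & y = s`_j) ->
  coord (in_tuple s) k x = 0.
  move=> xt st; apply: (span_memP (P := fun x => coord (in_tuple s) k x = 0)) xt.
  - by rewrite linear0.
  - by move=> a y z y0 z0; rewrite linearP /= y0 z0 mulr0 addr0.
  move=> y /st[j neqjk ->].
  by rewrite (@coord_free _ _ _ (in_tuple s)) ?(basis_free bX) // (negPf neqjk).
exists (size s), (size A), (size (A ++ B)), (in_tuple s).
split=> //; last split.
- by rewrite size_cat leq_addr.
- move=> i ltiq; rewrite -(span_basis bAB) memv_span //= nthAB //.
  exact: mem_nth.
- move=> i lepi; rewrite -(span_basis bBC) memv_span //= nthBC //.
  by rewrite mem_nth // ltn_subLR // -size_cat; apply: ltn_ord.
- move=> x k; rewrite -{1}(span_basis bAB) => xAB leqk; apply: coord0 xAB _.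
  move=> y yAB.
  have ltyq : (index y (A ++ B) < size (A ++ B))%N by rewrite index_mem.
  have ltys : (index y (A ++ B) < size s)%N.
    by rewrite /s catA size_cat ltn_addr.
  exists (Ordinal ltys); last by rewrite /= nthAB // nth_index.
  by rewrite neq_ltn /= (leq_trans ltyq).
- move=> x k; rewrite -{1}(span_basis bBC) => xBC ltkp; apply: coord0 xBC _.
  move=> y yBC.
  have ltyq : (index y (B ++ C) < size (B ++ C))%N by rewrite index_mem.
  have ltys : (size A + index y (B ++ C) < size s)%N by rewrite size_cat ltn_add2l.
  exists (Ordinal ltys).
    by rewrite neq_ltn /= (leq_trans ltkp) ?orbT // leq_addr.
  by rewrite /= nthBC ?leq_addr // addKn nth_index.
Qed.

Theorem two_sided_character bm bp lam :
    is_subalgebra bm -> is_subalgebra bp -> (bm + bp)%VS = fullv ->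
    scalar lam ->
    (forall x y, x \in bm -> y \in bm -> lam [lie x, y] = 0) ->
    (forall x y, x \in bp -> y \in bp -> lam [lie x, y] = 0) ->
  exists Phi : uenv g -> F,
    [/\ scalar Phi, Phi 1 = 1, left_char bm lam Phi, right_char bp lam Phi
      & forall Psi : uenv g -> F,
          scalar Psi -> left_char bm lam Psi -> right_char bp lam Psi ->
        forall u, Psi u = Psi 1 * Phi u].
Proof.
move=> bm_sub bp_sub bmp lam_lin lam_bm lam_bp.
have [n [p [q [X [Xb lepq Xm Xp [cm cp]]]]]] := adapted_basis bmp.
have coordK x : x = \sum_i coord X i x *: X`_i.
  by apply: coord_basis Xb _; rewrite memvf.
have lamE x : lam x = \sum_i coord X i x * lam X`_i.
  rewrite {1}[x]coordK scalarf_sum //.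
  by apply: eq_bigr => i _; rewrite scalarfZ.
pose G := char_nf X lam.
have Gc : compatible X G by apply: char_nf_compatible.
have Gl (i : 'I_n) w : (i < q)%N -> G (i :: w) = lam X`_i * G w.
  apply: char_nf_cons => // [j k ltj ltk|j k l ltj ltk lel].
    by apply: lam_bm; apply: Xm.
  by apply: cm => //; apply: bm_sub; apply: Xm.
have Gr (i : 'I_n) w : (p <= i)%N -> G (rcons w i) = lam X`_i * G w.
  apply: char_nf_rcons => // [j k ltj ltk|j k l ltj ltk lel].
    by apply: lam_bp; apply: Xp.
  by apply: cp => //; apply: bp_sub; apply: Xp.
(* The value at the empty word of the translate of G by u; the choice of representative is harmless
   by [uact_cong]. *)
pose Phi (u : uenv g) := uact X (repr u) G [::].
have PhiE s : Phi (upi s) = uact X s G [::].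
  by rewrite /Phi (uact_cong Xb (repr_upi s)).
have Phi_lin : scalar Phi.
  move=> a; elim/uenv_ind=> s; elim/uenv_ind=> t.
  have -> : a *: upi s + upi t = upi (UAdd (UMul (UCst g a) s) t).
    by rewrite [RHS]upi_add upi_mul.
  by rewrite !PhiE.
have Phi1 : Phi 1 = 1.
  by rewrite -[1]/(upi (UCst g 1)) PhiE /= mul1r /G char_nf_nil.
have Phil : left_char bm lam Phi.
  move=> x u xbm; elim/uenv_ind: u => s.
  have -> : uinj x * upi s = upi (UMul (UGen x) s) by rewrite [RHS]upi_mul.
  rewrite !PhiE /= [lam x]lamE mulr_suml; apply: eq_bigr => k _.
  case: (ltnP k q) => [ltkq|leqk]; last by rewrite cm ?mul0r.
  have /uact_cons-> : forall w, G (k :: w) = lam X`_k * G w.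
    by move=> w; apply: Gl.
  by rewrite mulrA.
have Phir : right_char bp lam Phi.
  move=> x u xbp; elim/uenv_ind: u => s.
  have -> : upi s * uinj x = upi (UMul s (UGen x)) by rewrite [RHS]upi_mul.
  rewrite !PhiE /= -uactZ; congr uact; apply/funext => w.
  rewrite [lam x]lamE mulr_suml; apply: eq_bigr => k _.
  case: (leqP p k) => [lepk|ltkp]; last by rewrite cp ?mul0r.
  by rewrite cats1 Gr ?mulrA.
exists Phi; split=> // Psi Psi_lin Psil Psir u.
apply/eqP; rewrite -subr_eq0; apply/eqP.
(* D vanishes at 1 and inherits both character equations, so it vanishes on all words. *)
pose D u := Psi u - Psi 1 * Phi u.
have Dlin : scalar D.
  by move=> a x y; rewrite /D Psi_lin Phi_lin; ring.
apply: (scalar_uword0 Xb Dlin); apply: (two_sided_eq0 (lam := lam) lepq).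
- exact: uword_compatible.
- by rewrite /uword big_nil /D Phi1 mulr1 subrr.
- move=> i w ltiq; rewrite /uword big_cons /D Psil ?Phil ?Xm //; ring.
- move=> i w lepi; rewrite /uword -cats1 big_cat big_seq1 /D.
  by rewrite Psir ?Phir ?Xp //; ring.
Qed.

End TwoSided.

(** * Triangular decomposition from a Chevalley basis *)

Lemma span_map_sum (F : fieldType) (V : vectType F) (T : eqType) (f : T -> V)
    (s : seq T) v :
    uniq s -> v \in <<[seq f i | i <- s]>>%VS ->
  exists a, v = \sum_(i <- s) a i *: f i.
Proof.
move=> s_uniq; apply: (span_memP (P := fun v => exists a, v = _)).
- by exists (fun=> 0); rewrite big1 // => i _; rewrite scale0r.
- move=> c _ _ [a1 ->] [a2 ->]; exists (fun i => c * a1 i + a2 i).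
  rewrite scaler_sumr -big_split; apply: eq_bigr => i _ /=.
  by rewrite scalerDl scalerA.
- move=> _ /mapP[j js ->]; exists (fun i => (i == j)%:R).
  rewrite (bigD1_seq j) //= eqxx scale1r big1 ?addr0 // => i /negPf->.
  by rewrite scale0r.
Qed.

(** * Solvable subspaces and central elements *)

Section LieSubspaces.
Variables (F : fieldType) (g : lieAlgType F).
Implicit Types (U V : {vspace g}).

Lemma mem_lie_prodv U V u v :
  u \in U -> v \in V -> [lie u, v] \in lie_prodv U V.
Proof.
move=> uU vV; rewrite (coord_vbasis uU) (coord_vbasis vV) lie_suml.
apply: memv_suml => i _; rewrite lieZl memvZ // linear_sum.
apply: memv_suml => j _; rewrite linearZ memvZ //= memv_span //.
by apply: allpairs_f; rewrite mem_nth // size_tuple.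
Qed.

Lemma solvable_sl2 U (e f t : g) : (2%:R : F) != 0 -> solvable U ->
    e \in U -> f \in U -> t \in U ->
    [lie t, e] = 2%:R *: e -> [lie t, f] = - 2%:R *: f -> [lie e, f] = t ->
  e = 0.
Proof.
move=> two_neq0 [n Un0] eU fU tU te tf ef.
suff /and3P[] : [&& e \in iter n (fun V => lie_prodv V V) U,
    f \in iter n (fun V => lie_prodv V V) U
  & t \in iter n (fun V => lie_prodv V V) U].
  by rewrite Un0 memv0 => /eqP.
elim: n {Un0} => [|n /and3P[eV fV tV]]; first exact/and3P.
rewrite !iterS; apply/and3P; split; last by rewrite -ef mem_lie_prodv.
  rewrite -[X in X \in _](scalerK two_neq0) -te memvZ //.
  exact: mem_lie_prodv.
have n2 : - (2%:R : F) != 0 by rewrite oppr_eq0.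
by rewrite -[X in X \in _](scalerK n2) -tf memvZ // mem_lie_prodv.
Qed.

(** The line through a central element is an abelian ideal. *)
Lemma semisimple_center0 (z : g) :
  semisimple g -> (forall x, [lie x, z] = 0) -> z = 0.
Proof.
move=> g_ss zc; suff : z \in 0%VS by rewrite memv0 => /eqP.
rewrite -(g_ss <[z]>%VS) ?memv_line //.
  by move=> x y /vlineP[c ->]; rewrite linearZ /= zc scaler0 mem0v.
exists 1%N => /=; apply/eqP; rewrite -subv0; apply/span_subvP => y.
case/allpairsP=> [[u v] /= [/vbasis_mem/vlineP[c ->] /vbasis_mem/vlineP[d ->] ->]].
by rewrite linearZ /= lieZl zc !scaler0 mem0v.
Qed.

End LieSubspaces.

(** * The Borel subalgebra and its opposite *)

Section ChevalleyStructure.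
Variables (F : fieldType) (g : lieAlgType F) (h b : subalgebra g).
Variable B : chevalley_basis h b.
Hypothesis two_neq0 : (2%:R : F) != 0.
Hypothesis g_ss : semisimple g.
Hypothesis b_solv : solvable b.
Hypothesis hb : (subalg_vs h <= subalg_vs b)%VS.
Implicit Types (al be ga : 'Hom(subvs_of h, F^o)) (t : subvs_of h).

Local Notation pos := (pos_roots B).
Local Notation simp := (simple_roots B).
Local Notation xx := (chev_x B).
Local Notation yy := (chev_y B).
Local Notation hh := (fun al => vsval (chev_h B al)).
Local Notation xs := [seq chev_x B al | al <- pos_roots B].
Local Notation ys := [seq chev_y B al | al <- pos_roots B].
Local Notation hs := [seq vsval (chev_h B al) | al <- simple_roots B].

Lemma root_space_lie al be u v :
  in_root_space al u -> in_root_space be v ->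
  in_root_space (al + be) [lie u, v].
Proof.
move=> ualpha vbeta t; rewrite lie_der ualpha vbeta lieZl linearZ /=.
by rewrite add_lfunE scalerDl.
Qed.

Lemma simple_pos al : al \in simp -> al \in pos.
Proof. by move=> /simple_rootsP[/pos_rootsP]. Qed.

Lemma cartan_sub_borel t : vsval t \in subalg_vs b.
Proof. exact: subvP hb _ (subvsP t). Qed.

Lemma chev_h_neq0 al : al \in pos -> chev_h B al != 0.
Proof.
by move=> /chev_coroot; apply: contra_eq_neq => ->; rewrite linear0 eq_sym.
Qed.

Lemma chev_x_neq0 al : al \in pos -> xx al != 0.
Proof.
move=> al_pos; apply: contra_neq (chev_h_neq0 al_pos) => x0.
by apply: val_inj; rewrite /= -(chev_xy al_pos) x0 lie0l.
Qed.

Lemma chev_y_neq0 al : al \in pos -> yy al != 0.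
Proof.
move=> al_pos; apply: contra_neq (chev_h_neq0 al_pos) => y0.
by apply: val_inj; rewrite /= -(chev_xy al_pos) y0 linear0.
Qed.

Lemma chev_x_borel al : al \in pos -> xx al \in subalg_vs b.
Proof.
by move=> al_pos; have /pos_rootsP[_ ->//] := al_pos; apply: chev_x_root.
Qed.

(** Otherwise the solvable b would contain the sl2-triple of x, y and the coroot. *)
Lemma chev_y_notin_borel al : al \in pos -> yy al \notin subalg_vs b.
Proof.
move=> al_pos; apply/negP => yb; have /eqP[] := chev_x_neq0 al_pos.
apply: (solvable_sl2 two_neq0 b_solv (chev_x_borel al_pos) yb
  (cartan_sub_borel (chev_h B al))); last exact: chev_xy.
  by rewrite chev_x_root // chev_coroot.
by rewrite chev_y_root // opp_lfunE chev_coroot.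
Qed.

Lemma opp_notin_pos al : al \in pos -> - al \notin pos.
Proof.
move=> al_pos; apply: contra (chev_y_notin_borel al_pos) => /pos_rootsP[_].
by apply; apply: chev_y_root.
Qed.

Lemma pos_neq0 al : al \in pos -> al != 0.
Proof. by move=> /pos_rootsP[[]]. Qed.

Lemma is_root_pos al : al \in pos -> is_root al.
Proof. by move=> /pos_rootsP[]. Qed.

Lemma is_root_opp_pos al : al \in pos -> is_root (- al).
Proof.
move=> al_pos; split; first by rewrite oppr_eq0 pos_neq0.
by exists (yy al); [apply: chev_y_root | apply: chev_y_neq0].
Qed.

(* [ad t + be t] kills y_be and multiplies y_al by [be t - al t]. *)
Lemma chev_y_sum_borel (s : seq 'Hom(subvs_of h, F^o)) a :
    uniq s -> {subset s <= pos} ->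
    \sum_(al <- s) a al *: yy al \in subalg_vs b ->
  forall al, al \in s -> a al = 0.
Proof.
elim: s a => // be s IH a /= /andP[be_s s_uniq] s_pos.
rewrite big_cons => pb.
have s_pos' : {subset s <= pos} by move=> al als; rewrite s_pos // inE als orbT.
have be_pos : be \in pos by rewrite s_pos // mem_head.
have a0 al : al \in s -> a al = 0.
  move=> als; apply/eqP; apply: contraNT be_s => a_neq0.
  (* The induction hypothesis applies to the combination from which [yy be] has been removed, and
     gives (be t - al t) a al = 0 for every t. *)
  suff -> : be = al by [].
  apply/lfunP => t; apply/eqP; rewrite -subr_eq0; apply/eqP.
  apply: (mulIf a_neq0); rewrite mul0r.
  pose c ga : F := ((be t : F) - (ga t : F)) * a ga.
  apply: (IH c) => //; have -> : \sum_(ga <- s) c ga *: yy ga =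
      [lie vsval t, a be *: yy be + \sum_(al <- s) a al *: yy al]
        + (be t : F) *: (a be *: yy be + \sum_(al <- s) a al *: yy al).
    rewrite linearD linearZ /= chev_y_root // opp_lfunE scalerDr addrACA.
    rewrite scaleNr scalerN !scalerA [a be * _]mulrC addNr add0r.
    rewrite linear_sum scaler_sumr -big_split /= big_seq [RHS]big_seq.
    apply: eq_bigr => ga gas; rewrite linearZ /= chev_y_root ?s_pos' //.
    by rewrite opp_lfunE !scalerA -scalerDl /c; congr (_ *: _); ring.
  by rewrite memvD ?memvZ // subalgP ?cartan_sub_borel.
move=> al; rewrite inE => /predU1P[->|]; last exact: a0.
apply/eqP; apply: contraNT (chev_y_notin_borel be_pos) => a_neq0.
rewrite big_seq big1 in pb => [|ga gas]; last by rewrite a0 ?scale0r.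
by move: pb; rewrite addr0 => /(memvZ (a be)^-1); rewrite scalerK.
Qed.

Lemma chev_y_cap_borel : (subalg_vs b :&: <<ys>> = 0)%VS.
Proof.
apply/eqP; rewrite -subv0; apply/subvP => v; rewrite memv_cap => /andP[vb].
case/(span_map_sum (pos_roots_uniq B)) => a ev; rewrite ev in vb *.
rewrite big_seq big1 ?mem0v // => al al_pos.
by rewrite (chev_y_sum_borel (pos_roots_uniq B) _ vb) ?scale0r.
Qed.

Lemma chev_xh_sub_borel : (<<xs ++ hs>> <= subalg_vs b)%VS.
Proof.
apply/span_subvP => v; rewrite mem_cat => /orP[]/mapP[al al_in ->].
  exact: chev_x_borel.
exact: cartan_sub_borel.
Qed.

Lemma chev_span : (<<ys>> + <<xs ++ hs>> = fullv)%VS.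
Proof. by rewrite -span_cat (span_basis (chev_basis B)). Qed.

Lemma borelE : subalg_vs b = <<xs ++ hs>>%VS.
Proof.
apply/eqP; rewrite eqEsubv chev_xh_sub_borel andbT; apply/subvP => v vb.
have : v \in fullv by rewrite memvf.
rewrite -chev_span => /memv_addP[y yY [w wXH ev]].
have wb := subvP chev_xh_sub_borel _ wXH.
suff /eqP y0 : y == 0 by rewrite ev y0 add0r.
rewrite -memv0 -chev_y_cap_borel memv_cap yY andbT.
by rewrite -(addrK w y) -ev memvB.
Qed.

(** Both arguments act on a root space by scalars, so their bracket z kills every root vector. It
    then kills the coroots, which are brackets of root vectors, so z is central in g. *)
Lemma cartan_abelian (t t' : subvs_of h) : [lie vsval t, vsval t'] = 0.
Proof.
set z := [lie _, _]; have zh : z \in subalg_vs h by rewrite subalgP ?subvsP.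
have zroot al v : in_root_space al v -> [lie z, v] = 0.
  move=> valpha; have := lie_der (vsval t) (vsval t') v.
  rewrite !valpha !linearZ /= !valpha !scalerA mulrC => /eqP.
  by rewrite -subr_eq subrr eq_sym => /eqP.
apply: semisimple_center0 => // v; rewrite lieC.
suff -> : [lie z, v] = 0 by rewrite oppr0.
have zx al : al \in pos -> [lie z, xx al] = 0.
  by move=> al_pos; apply: zroot (chev_x_root al_pos).
have zy al : al \in pos -> [lie z, yy al] = 0.
  by move=> al_pos; apply: zroot (chev_y_root al_pos).
have : v \in fullv by rewrite memvf.
rewrite -(span_basis (chev_basis B)).
apply: (span_memP (P := fun v => [lie z, v] = 0)) => [|a u w zu zw|u].
- by rewrite linear0.
- by rewrite linearP /= zu zw scaler0 addr0.
rewrite !mem_cat => /or3P[]/mapP[al al_in ->]; [exact: zy|exact: zx|].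
have al_pos := simple_pos al_in.
by rewrite -(chev_xy al_pos) lie_der zx // zy // lie0l linear0 addr0.
Qed.

Lemma chev_h_root t : in_root_space (0 : 'Hom(subvs_of h, F^o)) (vsval t).
Proof. by move=> t'; rewrite cartan_abelian zero_lfunE scale0r. Qed.

(** Comparing coordinates in [t, v] = mu(t) v: a basis vector occurring in v with nonzero
    coefficient has weight mu. *)
Lemma root_space_span (W : seq (g * 'Hom(subvs_of h, F^o))) mu v :
    basis_of fullv [seq p.1 | p <- W] ->
    (forall p, p \in W -> in_root_space p.2 p.1) ->
    in_root_space mu v ->
  v \in <<[seq p.1 | p <- W & p.2 == mu]>>%VS.
Proof.
move=> Wb Wroot vmu; pose X := in_tuple [seq p.1 | p <- W].
have Xf : free X := basis_free Wb.
have vE : v = \sum_i coord X i v *: X`_i.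
  by apply: (@coord_basis _ _ fullv _ X v Wb); apply: memvf.
have nthW (i : 'I_(size X)) : (i < size W)%N by case: i => i; rewrite size_map.
pose p0 : g * 'Hom(subvs_of h, F^o) := (0, 0).
have XE (i : 'I_(size X)) : X`_i = (nth p0 W i).1.
  by rewrite (nth_map p0) // nthW.
rewrite vE; apply: memv_suml => i _.
have [->|ci] := eqVneq (coord X i v) 0; first by rewrite scale0r mem0v.
rewrite memvZ // memv_span // XE; apply: map_f.
rewrite mem_filter mem_nth ?nthW // andbT; apply/eqP/lfunP => t.
apply: (mulfI ci).
have : coord X i [lie vsval t, v] = coord X i ((mu t : F) *: v) by rewrite vmu.
rewrite linearZ /= {1}vE linear_sum.
have -> : \sum_j [lie vsval t, coord X j v *: X`_j] =
    \sum_j (coord X j v * (nth p0 W j).2 t) *: X`_j.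
  apply: eq_bigr => j _; rewrite linearZ /= XE Wroot ?mem_nth ?nthW //.
  by rewrite scalerA.
by rewrite coord_sum_free // => ->; rewrite mulrC.
Qed.

Definition chev_weights : seq (g * 'Hom(subvs_of h, F^o)) :=
  [seq (yy al, - al) | al <- pos] ++ [seq (xx al, al) | al <- pos]
    ++ [seq (hh al, 0) | al <- simp].

Lemma chev_root_space mu v : in_root_space mu v ->
  v \in <<[seq p.1 | p <- chev_weights & p.2 == mu]>>%VS.
Proof.
apply: root_space_span.
  by rewrite !map_cat -!map_comp; apply: chev_basis.
move=> p; rewrite !mem_cat => /or3P[]/mapP[al al_in ->].
- exact: chev_y_root.
- exact: chev_x_root.
- exact: chev_h_root.
Qed.

(** The x's have positive weights and the h's weight 0, so only y's can have weight mu. *)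
Lemma nonpos_root_space mu v :
  mu \notin pos -> mu != 0 -> in_root_space mu v -> v \in <<ys>>%VS.
Proof.
move=> mu_npos mu0 /chev_root_space; apply: subvP; apply/span_subvP => u.
case/mapP=> p; rewrite mem_filter !mem_cat => /andP[/eqP pmu].
case/or3P=> /mapP[al al_in ep] ->; rewrite ep /= in pmu *.
- by rewrite memv_span // map_f.
- by rewrite pmu (negPf mu_npos) in al_in.
- by rewrite -pmu eqxx in mu0.
Qed.

(** The bracket has weight -(al + be), which is nonzero. If this weight is not positive, only y's
    have it. If it is positive, al + be is a negative root: [x_al, x_be] lies both in b and in the
    span of the y's, hence is 0, and [chev_struct] with constant 0 makes [y_al, y_be] vanish too. *)
Lemma chev_yy al be :
  al \in pos -> be \in pos -> [lie yy al, yy be] \in <<ys>>%VS.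
Proof.
move=> al_pos be_pos.
have := root_space_lie (chev_y_root al_pos) (chev_y_root be_pos).
rewrite -opprD; have [ga_pos|ga_npos] := boolP (- (al + be) \in pos); last first.
  apply: nonpos_root_space => //; rewrite oppr_eq0 addr_eq0.
  by apply: contraTneq al_pos => ->; apply: opp_notin_pos.
have abE : al + be = - - (al + be) by rewrite opprK.
have ab_root : is_root (al + be) by rewrite abE; apply: is_root_opp_pos.
have x0 : [lie xx al, xx be] = 0.
  apply/eqP; rewrite -memv0 -chev_y_cap_borel memv_cap.
  rewrite subalgP ?chev_x_borel //=; apply: (@nonpos_root_space (al + be)).
  - by rewrite abE opp_notin_pos.
  - by case: ab_root.
  - by apply: root_space_lie; apply: chev_x_root.
have := @chev_struct _ _ _ _ B al be 0
  (is_root_pos al_pos) (is_root_pos be_pos) ab_root.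
rewrite /chev_e al_pos be_pos (negPf (opp_notin_pos al_pos)).
rewrite (negPf (opp_notin_pos be_pos)) x0 !opprK oppr0 !scale0r => -> // _.
exact: mem0v.
Qed.

(** Gives two facts at once: the opposite Borel subspace is a subalgebra, and a functional vanishing
    on the y's vanishes on its brackets. *)
Lemma opp_borel_lie u v :
  u \in <<ys ++ hs>>%VS -> v \in <<ys ++ hs>>%VS -> [lie u, v] \in <<ys>>%VS.
Proof.
have hy t al : al \in pos -> [lie vsval t, yy al] \in <<ys>>%VS.
  by move=> al_pos; rewrite chev_y_root // memvZ // memv_span // map_f.
move=> us vs; move: u us.
apply: (span_memP (P := fun u => _ \in _)) => [|a x y xv yv|u us].
- by rewrite lie0l mem0v.
- by rewrite lieDl lieZl memvD ?memvZ.
move: v vs; apply: (span_memP (P := fun v => _ \in _)) => [|a x y xv yv|v vs].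
- by rewrite linear0 mem0v.
- by rewrite linearP /= memvD ?memvZ.
move: us vs; rewrite !mem_cat => /orP[]/mapP[al al_in ->] /orP[]/mapP[be be_in ->].
- exact: chev_yy.
- by rewrite lieC memvN hy.
- exact: hy.
- by rewrite cartan_abelian mem0v.
Qed.

End ChevalleyStructure.

(** * The contravariant form *)

Section Verma.
Variables (F : fieldType) (g : lieAlgType F) (b : subalgebra g).
Variables (L : lmodType (uenv (subvs_of b))) (e : L).
Hypothesis e_neq0 : e != 0.
Hypothesis e_gen :
  forall v : L, exists c : F, v = (c%:A : uenv (subvs_of b)) *: e.

(** [cL] is the coordinate on the line L with respect to e, and s |-> cL(s e) is the character by
    which U(b) acts; the last clause holds because scalars are central. *)
Lemma line_coord : exists cL : L -> F,
  [/\ forall v, v = ((cL v)%:A : uenv (subvs_of b)) *: e,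
      forall c : F, cL ((c%:A : uenv (subvs_of b)) *: e) = c,
      forall u v, cL (u + v) = cL u + cL v
    & forall (s : uenv (subvs_of b)) v, cL (s *: v) = cL (s *: e) * cL v].
Proof.
have [cL cLK] := choice e_gen; exists cL.
have inj (c d : F) : (c%:A : uenv (subvs_of b)) *: e = (d%:A : uenv _) *: e ->
    c = d.
  move=> ecd; apply/eqP; rewrite -subr_eq0; apply: contraR e_neq0 => cd0.
  rewrite -[e]scale1r.
  have -> : 1 = ((c - d)^-1)%:A * (c - d)%:A :> uenv (subvs_of b).
    by rewrite mulr_algl scalerA mulVf ?scale1r.
  by rewrite -scalerA [(c - d)%:A]scalerBl scalerBl ecd subrr scaler0.
split=> // [c|u v|s v]; apply: inj; first by rewrite -cLK.
  by rewrite -cLK scalerDl scalerDl -!cLK.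
rewrite -cLK {1}[v]cLK scalerA.
have -> : s * (cL v)%:A = (cL v)%:A * s by rewrite mulr_algr mulr_algl.
rewrite -[LHS]scalerA [in LHS](cLK (s *: e)) [LHS]scalerA.
by rewrite mulr_algl scalerA [cL v * _]mulrC.
Qed.

Lemma tpure0 : tpure (uincl b) 0 e = 0 :> verma L.
Proof.
by apply: (addrI (tpure (uincl b) 0 e)); rewrite -tpureDl !addr0.
Qed.

Lemma verma_cyclic (m : verma L) : exists a, tpure (uincl b) a e = m.
Proof.
elim/ext_scalars_pure_ind: m => [|a n|_ [a <-]|_ _ [a <-] [a' <-]].
- by exists 0; apply: tpure0.
- have [c ->] := e_gen n; exists (a * uincl b c%:A).
  by rewrite tpure_balanced.
- exists (- a); apply/eqP; rewrite -subr_eq0 opprK -tpureDl addNr.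
  by apply/eqP/tpure0.
- by exists (a + a'); rewrite tpureDl.
Qed.

(** The right equation passes from b to all of U(b), with the character s |-> cL(s e) extending
    [lam]. *)
Lemma right_char_uincl (cL : L -> F) (lam : g -> F) (Phi : uenv g -> F) :
    (forall u v, cL (u + v) = cL u + cL v) ->
    (forall c : F, cL ((c%:A : uenv (subvs_of b)) *: e) = c) ->
    (forall (s : uenv (subvs_of b)) v, cL (s *: v) = cL (s *: e) * cL v) ->
    (forall x : subvs_of b, lam (vsval x) = cL (uinj x *: e)) ->
    scalar Phi -> right_char b lam Phi ->
  forall a s, Phi (a * uincl b s) = cL (s *: e) * Phi a.
Proof.
move=> cLD cLA cLM lamE Phi_lin Phir a; elim/uenv_ind=> s.
rewrite /uincl uext_upi; last exact: uincl_lie_morphism.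
elim: s a => [c|x|s IHs t IHt|s IHs t IHt] a /=.
- by rewrite -[upi _]/(ucst _ c) ucstE cLA mulr_algr (scalarfZ Phi_lin).
- by rewrite Phir ?subvsP // lamE.
- have -> : upi (UAdd s t) = upi s + upi t := upi_add s t.
  by rewrite mulrDr (scalarfD Phi_lin) IHs IHt scalerDl cLD mulrDl.
- have -> : upi (UMul s t) = upi s * upi t := upi_mul s t.
  by rewrite mulrA IHt IHs -scalerA (cLM _ (_ *: _)) mulrCA mulrA.
Qed.

(** The map (a, n) |-> cL(n) Phi(a) is biadditive and balanced over U(b), so Phi factors through the
    Verma module. *)
Lemma tpure_functional (cL : L -> F) (Phi : uenv g -> F) :
    (forall u v, cL (u + v) = cL u + cL v) ->
    (forall c : F, cL ((c%:A : uenv (subvs_of b)) *: e) = c) ->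
    (forall (s : uenv (subvs_of b)) v, cL (s *: v) = cL (s *: e) * cL v) ->
    scalar Phi -> (forall a s, Phi (a * uincl b s) = cL (s *: e) * Phi a) ->
  forall a a', tpure (uincl b) a e = tpure (uincl b) a' e -> Phi a = Phi a'.
Proof.
move=> cLD cLA cLM Phi_lin PhiM a a' /tpiP eaa'.
have cLe : cL e = 1 by rewrite -[e]scale1r -[1]scale1r cLA.
have := teval_cong (f := fun a n => cL n * Phi a) _ _ _ eaa'.
rewrite /= cLe !mul1r; apply=> [c c' n|c n n'|c s n].
- by rewrite (scalarfD Phi_lin) mulrDr.
- by rewrite cLD mulrDl.
- by rewrite PhiM [cL (s *: n)]cLM mulrCA mulrA.
Qed.

End Verma.

(** * The character equations under tau *)

Section ContravariantForm.
Variables (F : fieldType) (g : lieAlgType F) (h b : subalgebra g).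
Variable B : chevalley_basis h b.
Hypothesis two_neq0 : (2%:R : F) != 0.
Hypothesis g_ss : semisimple g.
Hypothesis b_solv : solvable b.
Hypothesis hb : (subalg_vs h <= subalg_vs b)%VS.
Variable tau : {linear uenv g -> uenv g}.
Hypothesis tauP : is_tau B tau.

Local Notation xs := [seq chev_x B al | al <- pos_roots B].
Local Notation ys := [seq chev_y B al | al <- pos_roots B].
Local Notation hs := [seq vsval (chev_h B al) | al <- simple_roots B].

(** The square of [tau] is multiplicative and fixes the Chevalley basis, which generates U(g). *)
Lemma tauK : involutive tau.
Proof.
have [_ [tau1 tauM] taux tauy tauh] := tauP.
have tau_gen x : tau (tau (uinj x)) = uinj x.
  have : x \in fullv by rewrite memvf.
  rewrite -(span_basis (chev_basis B)).
  apply: (span_memP (P := fun x => tau (tau (uinj x)) = uinj x)) => [|a u v tu tv|u].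
  - by rewrite uinj0 !linear0.
  - by rewrite uinjD uinjZ !linearP /= tu tv.
  rewrite !mem_cat => /or3P[]/mapP[al al_in ->].
  - by rewrite tauy ?taux.
  - by rewrite taux ?tauy.
  - by rewrite !tauh.
elim/uenv_ind; elim=> [c|x|s IHs t IHt|s IHs t IHt].
- by rewrite -[upi _]/(ucst g c) ucstE !linearZ /= !tau1.
- exact: tau_gen.
- have -> : upi (UAdd s t) = upi s + upi t := upi_add s t.
  by rewrite !linearD /= IHs IHt.
- have -> : upi (UMul s t) = upi s * upi t := upi_mul s t.
  by rewrite !tauM IHs IHt.
Qed.

Variables (lam : g -> F) (Phi : uenv g -> F).
Hypothesis lam_lin : scalar lam.
Hypothesis lam_y : forall al, al \in pos_roots B -> lam (chev_y B al) = 0.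
Hypothesis lam_x : forall al, al \in pos_roots B -> lam (chev_x B al) = 0.

Lemma left_char_span (s : seq g) (Psi : uenv g -> F) : scalar Psi ->
    (forall x u, x \in s -> Psi (uinj x * u) = lam x * Psi u) ->
  left_char <<s>>%VS lam Psi.
Proof.
move=> Psi_lin Psis x u xs; move: x xs u.
apply: (span_memP (P := fun x => forall u, _ = _)) => [u|a x y xu yu u|x xs u].
- by rewrite uinj0 mul0r (scalarf0 Psi_lin) (scalarf0 lam_lin) mul0r.
- rewrite uinjD uinjZ mulrDl -scalerAl Psi_lin lam_lin xu yu mulrDl.
  by rewrite mulrA.
- exact: Psis.
Qed.

Lemma right_char_span (s : seq g) (Psi : uenv g -> F) : scalar Psi ->
    (forall x u, x \in s -> Psi (u * uinj x) = lam x * Psi u) ->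
  right_char <<s>>%VS lam Psi.
Proof.
move=> Psi_lin Psis x u xs; move: x xs u.
apply: (span_memP (P := fun x => forall u, _ = _)) => [u|a x y xu yu u|x xs u].
- by rewrite uinj0 mulr0 (scalarf0 Psi_lin) (scalarf0 lam_lin) mul0r.
- rewrite uinjD uinjZ mulrDr -scalerAr Psi_lin lam_lin xu yu mulrDl.
  by rewrite mulrA.
- exact: Psis.
Qed.

Lemma scalar_tau (Psi : uenv g -> F) : scalar Psi -> scalar (Psi \o tau).
Proof. by move=> Psi_lin a u v; rewrite /= linearP Psi_lin. Qed.

(** [tau] reverses products, exchanges x's and y's and fixes the h's; [lam] takes the same value 0
    on x's and y's. The right equation for b thus becomes the left one for the opposite Borel
    subalgebra. *)
Lemma left_char_tau :
  scalar Phi -> right_char b lam Phi ->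
  left_char <<ys ++ hs>>%VS lam (Phi \o tau).
Proof.
move=> Phi_lin Phir; apply: left_char_span (scalar_tau Phi_lin) _ => x u /=.
have [_ [_ tauM] _ tauy tauh] := tauP; rewrite tauM mem_cat.
case/orP=> /mapP[al al_in ->].
  by rewrite tauy // Phir ?chev_x_borel // lam_x // lam_y.
by rewrite tauh // Phir // cartan_sub_borel.
Qed.

Lemma right_char_tau :
  scalar Phi -> left_char <<ys ++ hs>>%VS lam Phi ->
  right_char b lam (Phi \o tau).
Proof.
move=> Phi_lin Phil; rewrite (borelE B two_neq0 b_solv hb).
apply: right_char_span (scalar_tau Phi_lin) _ => x u /=.
have [_ [_ tauM] taux _ tauh] := tauP; rewrite tauM mem_cat.
case/orP=> /mapP[al al_in ->].
  rewrite taux // Phil ?lam_x ?lam_y //.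
  by rewrite memv_span // mem_cat map_f.
rewrite tauh // Phil // memv_span // mem_cat.
by apply/orP; right; apply/mapP; exists al.
Qed.

End ContravariantForm.

(** * Existence and uniqueness of the form *)

Theorem verma_contravariant_form (F : fieldType) (g : lieAlgType F)
    (h b : subalgebra g) (B : chevalley_basis h b)
    (tau : {linear uenv g -> uenv g})
    (L : lmodType (uenv (subvs_of b))) (e : L) :
    (2%:R : F) != 0 -> semisimple g -> solvable b ->
    (subalg_vs h <= subalg_vs b)%VS -> is_tau B tau ->
    e != 0 ->
    (forall v : L, exists c : F, v = (c%:A : uenv (subvs_of b)) *: e) ->
    (forall (x : subvs_of b) (v : L),
      vsval x \in lie_prodv b b -> uinj x *: v = 0) ->
  exists form : verma L -> verma L -> F,
    [/\ contravariant_form tau form,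
        exists v w : verma L, form v w != 0
      & forall form' : verma L -> verma L -> F,
          contravariant_form tau form' ->
          exists c : F, forall v w : verma L, form' v w = c * form v w].
Proof.
move=> two_neq0 g_ss b_solv hb tauP e_neq0 e_gen nL.
have [cL [cLK cLA cLD cLM]] := line_coord e_neq0 e_gen.
pose ys := [seq chev_y B al | al <- pos_roots B].
pose hs := [seq vsval (chev_h B al) | al <- simple_roots B].
have b_cap_ys : (subalg_vs b :&: <<ys>> = 0)%VS.
  exact: (chev_y_cap_borel B two_neq0 b_solv hb).
(* The projection onto b along the span of the y's; through it the character of b on L extends to g
   by 0 on the y's. *)
pose bpi := daddv_pi b <<ys>>%VS.
have bpi_b x : x \in subalg_vs b -> bpi x = x by apply: daddv_pi_id.
have bpi_y x : x \in <<ys>>%VS -> bpi x = 0.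
  move=> xY; have := @daddv_pi_add _ _ b <<ys>>%VS x b_cap_ys.
  rewrite [daddv_pi <<ys>>%VS _ _]daddv_pi_id // 1?capvC //.
  rewrite (subvP (addvSr _ _) _ xY) => /(_ isT) bpix.
  by apply: (addIr x); rewrite add0r.
pose lam x := cL (uinj (vsproj b (bpi x)) *: e).
have lamE (x : subvs_of b) : lam (vsval x) = cL (uinj x *: e).
  by rewrite /lam bpi_b ?subvsP // vsvalK.
have lam_lin : scalar lam.
  move=> a x y; rewrite /lam linearP /= linearP /= uinjD uinjZ scalerDl cLD.
  by rewrite -mulr_algl -scalerA cLM cLA.
have lam_ys x : x \in <<ys>>%VS -> lam x = 0.
  move=> xY; rewrite /lam bpi_y // linear0 uinj0 scale0r.
  by have := cLA 0; rewrite !scale0r.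
have lam_y al : al \in pos_roots B -> lam (chev_y B al) = 0.
  by move=> al_pos; apply: lam_ys; rewrite memv_span // map_f.
have lam_bb x y : x \in subalg_vs b -> y \in subalg_vs b -> lam [lie x, y] = 0.
  move=> xb yb; have xyb := subalgP xb yb.
  rewrite -[[lie x, y]](vsprojK xyb) lamE nL.
    by have := cLA 0; rewrite !scale0r.
  by rewrite vsprojK // mem_lie_prodv.
have lam_x al : al \in pos_roots B -> lam (chev_x B al) = 0.
  (* x_al is half of [h_al, x_al], a bracket in b, where [lam] vanishes. *)
  move=> al_pos; rewrite -[chev_x B al](scalerK two_neq0).
  rewrite -(chev_coroot al_pos) -(chev_x_root al_pos) scalarfZ // lam_bb ?mulr0 //.
    exact: cartan_sub_borel.
  exact: chev_x_borel.
have bm_lie := opp_borel_lie two_neq0 g_ss b_solv hb (B := B).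
have bm_sub : is_subalgebra <<ys ++ hs>>%VS.
  move=> x y xm ym; have := bm_lie _ _ xm ym; apply: subvP.
  by rewrite span_cat addvSl.
have bm_b : (<<ys ++ hs>> + b = fullv)%VS.
  apply/eqP; rewrite eqEsubv subvf -(chev_span B) -(borelE B two_neq0 b_solv hb).
  by rewrite addvS // span_cat addvSl.
have [|Phi [Phi_lin Phi1 Phil Phir Phi_uniq]] :=
    two_sided_character bm_sub (@subalgP _ _ b) bm_b lam_lin _ lam_bb.
  by move=> x y xm ym; apply: lam_ys; apply: bm_lie.
have tau2 := tauK tauP; have [_ [tau1 tauM] taux tauy tauh] := tauP.
have Phi_tau u : Phi (tau u) = Phi u.
  rewrite -[RHS]mul1r -Phi1 -{1}tau1; apply: (Phi_uniq (Phi \o tau)).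
  - exact: scalar_tau.
  - exact: (left_char_tau hb tauP).
  - exact: (right_char_tau two_neq0 b_solv hb tauP).
have PhiM := right_char_uincl cLD cLA cLM lamE Phi_lin Phir.
have Phi_eq := tpure_functional cLD cLA cLM Phi_lin PhiM.
(* [sec] picks some u with v = u v0; [formE] shows that the form does not depend on the choice. *)
have [sec secK] := choice (verma_cyclic e_gen).
pose form v w := Phi (tau (sec v) * sec w).
pose v0 : verma L := tpure (uincl b) 1 e.
have tpureE a : tpure (uincl b) a e = a *: v0 by rewrite scale_tpure mulr1.
have Phi_eqr a c c' : c *: v0 = c' *: v0 -> Phi (a * c) = Phi (a * c').
  by move=> ecc'; apply: Phi_eq; rewrite !tpureE -!scalerA ecc'.
have formE a c : form (a *: v0) (c *: v0) = Phi (tau a * c).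
  rewrite /form (Phi_eqr _ _ c) -?tpureE ?secK ?tpureE //.
  (* Invariance of Phi under [tau] moves the first representative to the right end, where [Phi_eqr]
     can change it. *)
  rewrite -Phi_tau tauM tau2 (Phi_eqr _ _ a) -?tpureE ?secK //.
  by rewrite -Phi_tau tauM tau2.
have v0P (m : verma L) : exists a, m = a *: v0.
  by exists (sec m); rewrite -tpureE secK.
have lam_v0 x : x \in subalg_vs b -> uinj x *: v0 = ((lam x)%:A : uenv g) *: v0.
  move=> xb; rewrite -[x](vsprojK xb) lamE !scale_tpure !mulr1.
  have -> : uinj (vsval (vsproj b x)) = uincl b (uinj (vsproj b x)).
    by rewrite /uincl uext_uinj //; apply: uincl_lie_morphism.
  rewrite -[X in tpure _ X e]mul1r tpure_balanced [uinj _ *: e]cLK cLA.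
  rewrite -tpure_balanced mul1r; congr tpure.
  by rewrite -[in LHS]ucstE; apply: (uext_upi (uincl_lie_morphism b)).
exists form; split.
- split=> [v w|u v w|c v w|u v w].
  + have [[a ->] [c ->]] := (v0P v, v0P w).
    by rewrite !formE -Phi_tau tauM tau2.
  + have [[a ->] [c ->]] := (v0P u, v0P v); have [d ->] := v0P w.
    by rewrite -scalerDl !formE linearD mulrDl (scalarfD Phi_lin).
  + have [[a ->] [d ->]] := (v0P v, v0P w).
    by rewrite scalerA mulr_algl !formE linearZ /= -scalerAl (scalarfZ Phi_lin).
  + have [[a ->] [c ->]] := (v0P v, v0P w).
    by rewrite !scalerA !formE tauM mulrA.
- exists v0, v0; rewrite -[v0]scale1r formE tau1 mulr1 Phi1.
  exact: oner_neq0.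
move=> form' [form'C form'D form'Z form'tau].
(* The scalar is the value of [form'] at (v0, v0), where [form] takes the value 1. *)
pose Psi u := form' v0 (u *: v0); exists (Psi 1).
have Psi_lin : scalar Psi.
  move=> a x y; rewrite /Psi scalerDl form'C form'D -mulr_algl -scalerA form'Z.
  by rewrite !(form'C _ v0).
(* Contravariance turns x on the right argument into y on v0 in the left one, where y in b acts by
   [lam y]. *)
have Psil_gen x y u : y \in subalg_vs b -> tau (uinj y) = uinj x ->
    lam x = lam y -> Psi (uinj x * u) = lam x * Psi u.
  move=> yb ty exy; rewrite /Psi -scalerA -ty -form'tau lam_v0 // form'Z.
  by rewrite exy.
have Psil : left_char <<ys ++ hs>>%VS lam Psi.
  apply: left_char_span => // x u; rewrite mem_cat => /orP[]/mapP[al al_in ->].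
    apply: (Psil_gen _ (chev_x B al)); rewrite ?taux ?lam_x ?lam_y //.
    exact: chev_x_borel.
  by apply: Psil_gen (tauh _ al_in) _ => //; apply: cartan_sub_borel.
have Psir : right_char b lam Psi.
  move=> x u xb; rewrite /Psi -scalerA lam_v0 // scalerA mulr_algr.
  by rewrite -mulr_algl -scalerA form'C form'Z form'C.
move=> v w; have [[a ->] [c ->]] := (v0P v, v0P w).
by rewrite form'tau formE scalerA; apply: Phi_uniq.
Qed.

Unset Implicit Arguments.
Local Open Scope complex_scope.

Theorem corollary4p4 (R : realType) (g : lieAlgType R[i])
    (g_semisimple : semisimple g)
    (h b : subalgebra g) (h_cartan : is_cartan h) (b_borel : is_borel b)
    (h_sub_b : (subalg_vs h <= subalg_vs b)%VS)
    (B : chevalley_basis h b)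
    (tau : {linear uenv g -> uenv g}) (tauP : is_tau B tau)
    (lambda : 'Hom(subvs_of (subalg_vs h), R[i]^o))
    (L : lmodType (uenv (subvs_of (subalg_vs b))))
    (LP : is_C_lambda lambda L) :
  exists form : verma L -> verma L -> R[i],
    [/\ contravariant_form tau form,
        exists v w : verma L, form v w != 0
      & forall form' : verma L -> verma L -> R[i],
          contravariant_form tau form' ->
          exists c : R[i], forall v w : verma L, form' v w = c * form v w].
Proof.
have [[e e_neq0 e_gen] _ nL] := LP; have [b_solv _] := b_borel.
apply: (verma_contravariant_form _ g_semisimple b_solv h_sub_b tauP e_neq0) => //.
by rewrite Num.Theory.pnatr_eq0.
Qed.
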